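(* Let $A = \mathbb{C}\langle x_0,\dots,x_n\rangle/(x_ix_j - q_{ij}x_jx_i,\ 0\le i,j\le n)$ be a quantum polynomial algebra on $n+1$ variables with matrix $Q=(q_{ij})_{i,j}$ (all $q_{ij}\in\mathbb{C}^*$, $q_{ii}=1$, $q_{ji}=q_{ij}^{-1}$), and let $\mathrm{pts}(A)\subset\mathbb{P}^n$ be its point variety, where $\mathbb{P}^n=\mathbb{P}(A_1^* )$ has homogeneous coordinates $[u_0:\dots:u_n]$. Then: (1) $\mathrm{pts}(A) = \mathbb{V}\big((q_{ij}q_{jk}-q_{ik})u_iu_ju_k,\ 0\le i<j<k\le n\big)$, and hence $\mathrm{pts}(A)$ is the union of a collection of linear subspaces of the form $\mathbb{P}(i_0,\dots,i_k)$. (2) $\mathbb{P}(i_0,\dots,i_k)$ is an irreducible component of $\mathrm{pts}(A)$ if and only if the principal $(k+1)\times(k+1)$ minor (submatrix) $Q(i_0,\dots,i_k)=(q_{i_a i_b})_{0\le a,b\le k}$ of $Q$ is maximal among the principal minors of $Q$ such that $\operatorname{rk} Q(i_0,\dots,i_k)=1$. (3) $\mathrm{pts}(A)=\mathbb{V}\big(u_iu_ju_k;\ 0\le i<j<k\le n,\ \mathbb{P}(i,j,k)\not\subset \mathrm{pts}(A)\big)$. In particular, the point variety of $A$ is determined by the coordinate planes $\mathbb{P}^2=\mathbb{P}(u,v,w)$ it contains.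
   Context: A quantum polynomial algebra $A$ as in the claim is positively graded with every $x_i$ in degree one; $A_1$ is its degree-one part, with basis $x_0,\dots,x_n$. A point module of $A$ is a graded left $A$-module $P=P_0\oplus P_1\oplus\cdots$ which is cyclic (generated by one element of degree zero), critical (with respect to Gelfand–Kirillov dimension: every proper quotient has strictly smaller dimension; this implies that every normalizing element of $A$ acts on $P$ either as zero or as a non-zero-divisor), and has Hilbert series $(1-t)^{-1}$, i.e. $\dim_{\mathbb{C}}P_i=1$ for all $i\geq 0$. Such a $P$ can be written as $P\simeq A/(Al_1+\cdots+Al_n)$ with $l_1,\dots,l_n\in A_1$ linearly independent. To $P$ one associates the unique point $x_P=\mathbb{V}(l_1,\dots,l_n)\in\mathbb{P}^n=\mathbb{P}(A_1^* )$: if $l_m=\sum_i c_{mi}x_i$, then $x_P=[u_0:\dots:u_n]$ is the unique solution of $\sum_i c_{mi}u_i=0$ for $m=1,\dots,n$. The point variety of $A$ is the reduced closed subvariety $\mathrm{pts}(A)=\{x_P\in\mathbb{P}^n \mid P \text{ a point module of } A\}$. $\mathbb{V}(\cdot)$ denotes the (reduced) common zero locus in $\mathbb{P}^n$. For distinct indices $i_0,\dots,i_k\in\{0,\dots,n\}$, $\mathbb{P}(i_0,\dots,i_k)$ is the $k$-dimensional linear subspace of $\mathbb{P}^n$ spanned by the coordinate points $\delta_{i_0},\dots,\delta_{i_k}$, where $\delta_j=[\delta_{0j}:\dots:\delta_{nj}]$ (Kronecker deltas). ''Principal minor'' means the principal submatrix of $Q$ on a set of indices, and maximality is with respect to inclusion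 of index sets. *)

(* Defs.v *)
(* The notations of monalg and mpoly clash with those of MathComp-Analysis: both
   files are used under qualified names, importing only their canonical
   structures and coercions. *)
From HB Require Import structures.
From mathcomp Require Import all_boot all_order all_algebra.
From mathcomp Require Import generic_quotient ring_quotient.
From mathcomp Require Import boolp classical_sets reals ereal sequences exp.
From mathcomp Require Import complex.
From mathcomp.multinomials Require monalg mpoly.
Export (canonicals, coercions) monalg mpoly.

Set Implicit Arguments.
Unset Strict Implicit.
Unset Printing Implicit Defensive.

Import Order.TTheory GRing.Theory Num.Theory.
Import Quotient.
Local Open Scope classical_set_scope.
Local Open Scope ring_scope.
Local Open Scope quotient_scope.

Section TwoSidedQuotient.
Variables (K : fieldType) (F : algType K) (T : Type) (r : T -> F).

(* two-sided: F need not be commutative *)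
Definition gen_ideal : pred F := fun f =>
  `[< exists s : seq (F * T * F), f = \sum_(t <- s) t.1.1 * r t.1.2 * t.2 >].

Lemma gen_ideal_zmod : zmod_closed gen_ideal.
Proof.
split; first by apply/asboolP; exists [::]; rewrite big_nil.
move=> f g /asboolP[s ->] /asboolP[t ->]; apply/asboolP.
exists (s ++ [seq (- u.1.1, u.1.2, u.2) | u <- t]).
rewrite big_cat big_map -sumrN /=; congr (_ + _); apply: eq_bigr => u _.
by rewrite !mulNr.
Qed.
HB.instance Definition _ := GRing.isZmodClosed.Build F gen_ideal gen_ideal_zmod.

Lemma gen_idealMl (a f : F) : f \in gen_ideal -> a * f \in gen_ideal.
Proof.
move=> /asboolP[s ->]; apply/asboolP.
exists [seq (a * u.1.1, u.1.2, u.2) | u <- s].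
by rewrite big_map mulr_sumr; apply: eq_bigr => u _; rewrite !mulrA.
Qed.

Lemma gen_idealMr (a f : F) : f \in gen_ideal -> f * a \in gen_ideal.
Proof.
move=> /asboolP[s ->]; apply/asboolP.
exists [seq (u.1.1, u.1.2, u.2 * a) | u <- s].
by rewrite big_map mulr_suml; apply: eq_bigr => u _; rewrite !mulrA.
Qed.

Lemma gen_idealZ (c : K) (f : F) : f \in gen_ideal -> c *: f \in gen_ideal.
Proof. by rewrite -{2}[f]mul1r scalerAl; exact: gen_idealMl. Qed.

Lemma gen_ideal_proper (ev : {rmorphism F -> K}) :
  (forall t, ev (r t) = 0) -> 1 \notin gen_ideal.
Proof.
move=> ev0; apply/negP => /asboolP[s /(congr1 ev)]; rewrite rmorph1 rmorph_sum.
rewrite big1 => [/eqP|u _]; first by rewrite oner_eq0.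
by rewrite !rmorphM ev0 mulr0 mul0r.
Qed.

Definition gen_ideal_closed := GRing.ZmodClosed.clone F gen_ideal _.
Definition quot_alg := {quot gen_ideal_closed}.
HB.instance Definition _ := GRing.Zmodule.on quot_alg.
HB.instance Definition _ := EqQuotient.on quot_alg.

Definition quot_proj (f : F) : quot_alg := \pi_quot_alg f.

Lemma quot_projP f g : quot_proj f = quot_proj g <-> f - g \in gen_ideal.
Proof.
split=> [e|e]; first by rewrite (idealrBE gen_ideal_closed); apply/eqP.
by apply/eqP; move: e; rewrite (idealrBE gen_ideal_closed).
Qed.

Lemma quot_projD : {morph quot_proj : f g / f + g}.
Proof. by move=> f g; rewrite /quot_proj !piE. Qed.

Lemma quot_reprK (a : quot_alg) : quot_proj (repr a) = a.
Proof. exact: reprK. Qed.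

Lemma quot_ind (P : quot_alg -> Prop) : (forall f, P (quot_proj f)) -> forall a, P a.
Proof. by move=> Pf a; rewrite -[a]quot_reprK. Qed.

Definition quot_one : quot_alg := quot_proj 1.
Definition quot_mul (a b : quot_alg) : quot_alg := quot_proj (repr a * repr b).
Definition quot_scale (c : K) (a : quot_alg) : quot_alg := quot_proj (c *: repr a).

Lemma quot_projM f g : quot_proj (f * g) = quot_mul (quot_proj f) (quot_proj g).
Proof.
apply/quot_projP.
have Hf : f - repr (quot_proj f) \in gen_ideal.
  by apply/quot_projP; rewrite quot_reprK.
have Hg : g - repr (quot_proj g) \in gen_ideal.
  by apply/quot_projP; rewrite quot_reprK.
move: (repr (quot_proj f)) (repr (quot_proj g)) Hf Hg => f' g' Hf Hg.
rewrite (_ : _ - _ = (f - f') * g + f' * (g - g')).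
  by apply: (@rpredD _ gen_ideal_closed); [exact: gen_idealMr|exact: gen_idealMl].
by rewrite mulrBl mulrBr addrA subrK.
Qed.

Lemma quot_projZ c f : quot_proj (c *: f) = quot_scale c (quot_proj f).
Proof.
apply/quot_projP; rewrite -scalerBr gen_idealZ //.
by apply/quot_projP; rewrite quot_reprK.
Qed.

Lemma quot_mulA : associative quot_mul.
Proof.
elim/quot_ind => f; elim/quot_ind => g; elim/quot_ind => h.
by rewrite -!quot_projM mulrA.
Qed.

Lemma quot_mul1 : left_id quot_one quot_mul.
Proof. by elim/quot_ind => f; rewrite -quot_projM mul1r. Qed.

Lemma quot_1mul : right_id quot_one quot_mul.
Proof. by elim/quot_ind => f; rewrite -quot_projM mulr1. Qed.

Lemma quot_mulDl : left_distributive quot_mul +%R.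
Proof.
elim/quot_ind => f; elim/quot_ind => g; elim/quot_ind => h.
by rewrite -quot_projD -!quot_projM -quot_projD mulrDl.
Qed.

Lemma quot_mulDr : right_distributive quot_mul +%R.
Proof.
elim/quot_ind => f; elim/quot_ind => g; elim/quot_ind => h.
by rewrite -quot_projD -!quot_projM -quot_projD mulrDr.
Qed.

HB.instance Definition _ := GRing.Zmodule_isPzRing.Build quot_alg
  quot_mulA quot_mul1 quot_1mul quot_mulDl quot_mulDr.

Lemma quot_scaleA c d a : quot_scale c (quot_scale d a) = quot_scale (c * d) a.
Proof. by elim/quot_ind: a => f; rewrite -!quot_projZ scalerA. Qed.

Lemma quot_scale1 : left_id 1 quot_scale.
Proof. by elim/quot_ind => f; rewrite -quot_projZ scale1r. Qed.

Lemma quot_scaleDr : right_distributive quot_scale +%R.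
Proof.
move=> c; elim/quot_ind => f; elim/quot_ind => g.
by rewrite -quot_projD -!quot_projZ -quot_projD scalerDr.
Qed.

Lemma quot_scaleDl a : {morph quot_scale^~ a : c d / c + d}.
Proof. by elim/quot_ind: a => f c d; rewrite -!quot_projZ -quot_projD scalerDl. Qed.

HB.instance Definition _ := GRing.Zmodule_isLmodule.Build K quot_alg
  quot_scaleA quot_scale1 quot_scaleDr quot_scaleDl.

Lemma quot_scaleAl (c : K) (a b : quot_alg) : c *: (a * b) = (c *: a) * b.
Proof.
elim/quot_ind: a => f; elim/quot_ind: b => g.
by rewrite /GRing.scale /GRing.mul /= -!(quot_projM, quot_projZ) scalerAl.
Qed.

Lemma quot_scaleAr (c : K) (a b : quot_alg) : c *: (a * b) = a * (c *: b).
Proof.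
elim/quot_ind: a => f; elim/quot_ind: b => g.
by rewrite /GRing.scale /GRing.mul /= -!(quot_projM, quot_projZ) scalerAr.
Qed.

Lemma quot_oner_neq0 : 1 \notin gen_ideal -> 1 != 0 :> quot_alg.
Proof.
apply: contraNneq => e; rewrite -[1]subr0; apply/quot_projP.
rewrite -[LHS]/(1 : quot_alg) e.
by rewrite /quot_proj piE.
Qed.

End TwoSidedQuotient.

Lemma rmorph_qcomm0 (K : fieldType) (F : algType K) (ev : {rmorphism F -> K})
    (evZ : forall c f, ev (c *: f) = c * ev f) (c : K) (x y : F) :
  ev x = 0 -> ev y = 0 -> ev (x * y - c *: (y * x)) = 0.
Proof. by move=> x0 y0; rewrite rmorphB evZ !rmorphM x0 y0 !mul0r mulr0 subr0. Qed.

Lemma malg_scalerAr (K : fieldType) (M : monalg.MonomialDef.type) (c : K)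
  (f g : monalg.malg M K) : c *: (f * g) = f * (c *: g).
Proof.
apply/monalg.malgP => w; rewrite monalg.mcoeffZ monalg.mcoeffMl.
rewrite (@monalg.mcoeffMlw _ _ (monalg.msupp f) (monalg.msupp g)) //;
  last exact: monalg.msuppZ_le.
rewrite mulr_sumr; apply: eq_bigr => k1 _; rewrite mulr_sumr.
by apply: eq_bigr => k2 _; rewrite monalg.mcoeffZ mulrnAr mulrCA.
Qed.

Section QuantumPolynomialAlgebra.
Variables (K : fieldType) (n : nat).

(* K<x_0, ..., x_n>: the algebra of the free monoid of words in 'I_n.+1 *)
Definition free_alg := monalg.malg (monalg.fmonom 'I_n.+1) K.
HB.instance Definition _ := GRing.Lalgebra.on free_alg.

HB.instance Definition _ := GRing.Lalgebra_isAlgebra.Build K free_alg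
  (@malg_scalerAr K (monalg.fmonom 'I_n.+1)).

Definition free_gen (i : 'I_n.+1) : free_alg := monalg.mkmalgU (monalg.fmu i) 1.

Variable Q : 'M[K]_n.+1.

Definition qrel (ij : 'I_n.+1 * 'I_n.+1) : free_alg :=
  free_gen ij.1 * free_gen ij.2 - Q ij.1 ij.2 *: (free_gen ij.2 * free_gen ij.1).

Lemma qrel_proper : 1 \notin gen_ideal qrel.
Proof.
pose ev0 : {rmorphism free_alg -> K} :=
  @monalg.mcoeff (monalg.fmonom 'I_n.+1) K monalg.one.
have evZ c f1 : ev0 (c *: f1) = c * ev0 f1 by exact: monalg.mcoeffZ.
have ev_gen i : ev0 (free_gen i) = 0.
  rewrite /= monalg.mcoeffU; case: eqP => // /(congr1 (@monalg.fdeg _)).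
  by rewrite monalg.fdegU monalg.fdeg1.
apply: (gen_ideal_proper (ev := ev0)) => t.
exact: (@rmorph_qcomm0 K free_alg ev0 evZ (Q t.1 t.2) _ _ (ev_gen _) (ev_gen _)).
Qed.

(* K<x_0, ..., x_n>/(x_i x_j - q_ij x_j x_i), for an arbitrary matrix Q *)
Definition qalg := quot_alg qrel.
HB.instance Definition _ := GRing.PzRing.on qalg.
HB.instance Definition _ := GRing.Lmodule.on qalg.
HB.instance Definition _ :=
  GRing.PzSemiRing_isNonZero.Build qalg (quot_oner_neq0 qrel_proper).
HB.instance Definition _ :=
  GRing.Lmodule_isLalgebra.Build K qalg (@quot_scaleAl _ _ _ qrel).
HB.instance Definition _ :=
  GRing.Lalgebra_isAlgebra.Build K qalg (@quot_scaleAr _ _ _ qrel).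

Definition qx (i : 'I_n.+1) : qalg := quot_proj qrel (free_gen i).

(* A_d: the classes of the combinations of words of length d *)
Definition qdeg (d : nat) : set qalg :=
  [set a | exists2 f : free_alg,
     (forall w : monalg.fmonom 'I_n.+1, monalg.mcoeff w f != 0 -> size w = d)
     & a = quot_proj qrel f].

End QuantumPolynomialAlgebra.

Arguments qdeg {K n} Q d.
Arguments qx {K n} Q i.

Section GelfandKirillovDimension.
Variables (R : realType) (A : algType R[i]).

(* An A-module M is a C-vector space through c |-> c%:A. *)
Definition lin_indep (M : lmodType A) (d : nat) (b : 'I_d -> M) : Prop :=
  forall c : 'I_d -> R[i], \sum_i (c i)%:A *: b i = 0 -> forall i, c i = 0.

Definition lspan (M : lmodType A) (s : seq M) : set M :=
  [set v | exists c : nat -> R[i], v = \sum_(i < size s) (c i)%:A *: s`_i].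

(* the dimension of a C-subspace V of M, possibly +oo *)
Definition ldim (M : lmodType A) (V : set M) : \bar R :=
  ereal_sup [set (d%:R)%:E | d in
    [set d : nat | exists b : 'I_d -> M, (forall i, V (b i)) /\ lin_indep b]].

(* If V and W are the spans of a and s then gk_filtration a s k spans
   W + V W + ... + V^k W. *)
Fixpoint gk_filtration (M : lmodType A) (a : seq A) (s : seq M) (k : nat) : seq M :=
  if k is k'.+1 then
    let t := gk_filtration a s k' in t ++ [seq x *: v | x <- a, v <- t]
  else s.

(* the supremum over all finite a and s of
   limsup_k log dim (W + V W + ... + V^k W) / log k; GKdim 0 = -oo *)
Definition GKdim (M : lmodType A) : \bar R :=
  ereal_sup [set limn_esup (fun k : nat =>
      lne (ldim (lspan (gk_filtration as_.1 as_.2 k))) * ((ln k%:R)^-1)%:E)%E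
    | as_ in [set: seq A * seq M]].

(* A proper quotient of P is the target of a surjection with non-zero kernel. *)
Definition critical (P : lmodType A) : Prop :=
  forall (M : lmodType A) (f : {linear P -> M}),
    (forall v, exists u, f u = v) -> ~ injective f -> (GKdim M < GKdim P)%E.

End GelfandKirillovDimension.

Notation coord_ring K n := (mpoly.mpoly n.+1 K).

Section ProjectiveSpace.
Variables (K : fieldType) (n : nat).

(* P^n is the set of lines in K^(n+1); [u_0 : ... : u_n] is the line <[u]>. *)
Definition proj_space := {L : {vspace 'rV[K]_n.+1} | \dim L == 1%N}.

Definition pline (p : proj_space) : {vspace 'rV[K]_n.+1} := sval p.

Local Notation coord_ring := (coord_ring K n).

Definition ucoord (i : 'I_n.+1) : coord_ring := mpoly.mpolyX K (mpoly.mnm1 i).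

Definition zero_locus (S : set coord_ring) : set proj_space :=
  [set p | forall f, S f -> forall u : 'rV[K]_n.+1,
     u \in pline p -> u != 0 -> mpoly.meval (fun i => u 0 i) f = 0].

Definition homogeneous (f : coord_ring) : Prop :=
  exists d : nat, f \is mpoly.ishomog1 d (@mpoly.mdeg n.+1).

Definition zariski_closed (X : set proj_space) : Prop :=
  exists2 S : set coord_ring, (forall f, S f -> homogeneous f) & X = zero_locus S.

Definition irreducible (X : set proj_space) : Prop :=
  X !=set0 /\ forall Y Z, zariski_closed Y -> zariski_closed Z ->
    X `<=` Y `|` Z -> X `<=` Y \/ X `<=` Z.

Definition irreducible_component (X Y : set proj_space) : Prop :=
  [/\ Y `<=` X, zariski_closed Y, irreducible Y &
      forall Z, zariski_closed Z -> irreducible Z -> Y `<=` Z -> Z `<=` X -> Z = Y].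

(* P(i_0, ..., i_k) for s = [:: i_0; ...; i_k] *)
Definition coord_space (s : seq 'I_n.+1) : set proj_space :=
  [set p | (pline p <= <<[seq delta_mx 0%R j | j <- s]>>)%VS].

Definition principal_submx (Q : 'M[K]_n.+1) (k : nat) (s : k.-tuple 'I_n.+1) :
  'M[K]_k := \matrix_(a, b) Q (tnth s a) (tnth s b).

Definition quantum_matrix (Q : 'M[K]_n.+1) : Prop :=
  [/\ forall i j, Q i j != 0, forall i, Q i i = 1 & forall i j, Q j i = (Q i j)^-1].

End ProjectiveSpace.

Arguments ucoord {K n} i.
Arguments coord_space {K n} s.

Section PointModules.
Variables (R : realType) (n : nat) (Q : 'M[R[i]]_n.+1).
Let A := qalg Q.

(* P = P_0 + P_1 + ... (direct sum), with A_d P_i contained in P_(d+i) *)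
Definition graded_module (P : lmodType A) (gr : nat -> set P) : Prop :=
  [/\ forall i, gr i 0 /\
        (forall (c : R[i]) u v, gr i u -> gr i v -> gr i (c%:A *: u + v)),
      forall v, exists N (u : nat -> P),
        (forall i, gr i (u i)) /\ v = \sum_(i < N) u i,
      forall N (u : nat -> P), (forall i, gr i (u i)) ->
        \sum_(i < N) u i = 0 -> forall i, (i < N)%N -> u i = 0 &
      forall d i a v, qdeg Q d a -> gr i v -> gr (d + i)%N (a *: v)].

Definition point_module (P : lmodType A) (gr : nat -> set P) : Prop :=
  [/\ graded_module gr,
      exists2 e, gr 0%N e & forall v, exists a : A, v = a *: e,
      critical P &
      forall i, ldim (gr i) = 1%E].

(* An isomorphism P ~ A/(A l_1 + ... + A l_n) of graded modules is given as a
   surjection phi : A -> P with phi 1 in P_0 and kernel A l_1 + ... + A l_n. *)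
Definition associated_point (P : lmodType A) (gr : nat -> set P)
    (p : proj_space R[i] n) : Prop :=
  exists (c : 'M[R[i]]_(n, n.+1)) (phi : {linear A^o -> P}),
    let l m : A^o := \sum_i c m i *: qx Q i in
    [/\ lin_indep l,
        gr 0%N (phi 1),
        forall v, exists a, phi a = v,
        forall a, phi a = 0 <-> exists b : 'I_n -> A, a = \sum_m b m * l m &
        zero_locus
          [set \sum_i c m i *: (ucoord i : coord_ring R[i] n) | m in [set: 'I_n]]
        = [set p]].

Definition pts : set (proj_space R[i] n) :=
  [set p | exists (P : lmodType A) (gr : nat -> set P),
     point_module gr /\ associated_point gr p].

End PointModules.

(* Main.v *)
From HB Require Import structures.
Require Import Defs.
From mathcomp Require Import all_boot all_order all_algebra.
From mathcomp Require Import boolp classical_sets reals complex.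
From mathcomp Require Import ereal sequences exp.
From mathcomp Require Import ring.
From mathcomp Require finmap.
From mathcomp.multinomials Require monalg mpoly.
Import (canonicals, coercions) finmap.

(** The point variety consists of the points [u] whose support is a consistent set of
indices, one on which [q_ij q_jk = q_ik] for all [i], [j], [k]; everything else is
combinatorics of coordinate subspaces.

A point module has a basis [e_0, e_1, ...] with [e_d] in degree [d], and its point is the
vector [a] given by [x_i e_0 = a_i e_1]. If [x_i e_1 = b_i e_2], the defining relations of
the algebra read [a_j b_i = q_ij a_i b_j]. Hence [b] has the same support as [a], the ratios
[b_i / a_i] satisfy [b_i / a_i = q_ij b_j / a_j] on it, and the support is consistent
([pts_cocycle]).

Conversely, let the support of [u] be consistent and contain [o]. On the polynomial ring,
let [x_i] act by [X^k |-> u_i q_io^k X^(k+1)], that is, by [p |-> u_i X p(q_io X)]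
([twist_op]). Consistency is what the defining relations require of these operators. The
resulting module is generated by [1], because the powers of [x_o] reach every degree. It is
critical, because a non-zero submodule has finite codimension, so that proper quotients have
Gelfand-Kirillov dimension at most 0, while the module has dimension at least 1
([twisted_critical]). Its point is [u]: modulo the left ideal of the linear forms vanishing
at [u], the algebra is spanned by the powers of [x_o] ([forms_ideal_poly]), which act
independently on [1], so the annihilator of [1] is that left ideal ([twisted_associated]).

A coordinate subspace is then contained in the point variety if and only if its index set is
consistent ([coord_space_sub_pts]), which for planes means that a single triple is, and which
amounts to the submatrix having rank one ([rank1_consistent]). Coordinate subspaces are closed
and irreducible, and an irreducible subset of the point variety lies in a coordinate subspace
with consistent indices ([irreducible_pts_sub]), so the components correspond to the maximal
consistent sets ([component_iff_maximal]). *)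

Set Implicit Arguments.
Unset Strict Implicit.
Unset Printing Implicit Defensive.

Import Order.TTheory GRing.Theory Num.Theory.
Local Open Scope classical_set_scope.
Local Open Scope ring_scope.

(** * Dimension and Gelfand-Kirillov dimension *)

Section Dimension.
Variables (R : realType) (A : algType R[i]) (M : lmodType A).
Implicit Types (a b : A) (c d : R[i]) (v w z : M) (V : set M) (s : seq M).

Lemma algZA c d v : (c * d)%:A *: v = c%:A *: (d%:A *: v).
Proof. by rewrite scalerA -scalerAl mul1r scalerA. Qed.

Lemma algZK c v : c != 0 -> c^-1%:A *: (c%:A *: v) = v.
Proof. by move=> c0; rewrite -algZA mulVf // !scale1r. Qed.

Lemma algZ_eq0 c v : v != 0 -> c%:A *: v = 0 -> c = 0.
Proof.
move=> v0 cv0; apply/eqP; apply: contraNT v0 => c0.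
by rewrite -[v](algZK _ c0) cv0 scaler0.
Qed.

Lemma scale_algl c a v : (c *: a) *: v = c%:A *: (a *: v).
Proof. by rewrite scalerA mulr_algl. Qed.

Lemma scale_algr c a v : a *: (c%:A *: v) = c%:A *: (a *: v).
Proof. by rewrite !scalerA mulr_algl mulr_algr. Qed.

Lemma algZ_inj c d v : v != 0 -> c%:A *: v = d%:A *: v -> c = d.
Proof.
move=> v0 cd; apply/eqP; rewrite -subr_eq0; apply/eqP/(algZ_eq0 v0).
by rewrite scalerBl scalerBl cd subrr.
Qed.

Lemma qcomm_act c a b v : a * b = c *: (b * a) ->
  a *: (b *: v) = c%:A *: (b *: (a *: v)).
Proof. by move=> ab; rewrite scalerA ab scale_algl scalerA. Qed.

Lemma scale_act c d a v w : a *: v = d%:A *: w -> (c *: a) *: v = (c * d)%:A *: w.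
Proof. by move=> av; rewrite scale_algl av algZA. Qed.

Lemma act_comp c d a b v w z : b *: v = c%:A *: w -> a *: w = d%:A *: z ->
  a *: (b *: v) = (c * d)%:A *: z.
Proof. by move=> bv aw; rewrite bv scale_algr aw algZA. Qed.

(** Apply both sides of the skew commutation [a b = c b a] to [v]: going through lines spanned
by [v], [w] and [z], each side multiplies the structure constants of two successive steps. *)
Lemma qcomm_coef c a b v w z (av bv aw bw : R[i]) : z != 0 ->
  a * b = c *: (b * a) -> a *: v = av%:A *: w -> b *: v = bv%:A *: w ->
  a *: w = aw%:A *: z -> b *: w = bw%:A *: z -> bv * aw = c * (av * bw).
Proof.
move=> z0 ab hav hbv haw hbw; apply: (algZ_inj z0).
by rewrite [RHS]algZA -(act_comp hbv haw) -(act_comp hav hbw) (qcomm_act v ab).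
Qed.

Lemma scale_word2 d a b v : (d *: (a * (b * 1))) *: v = d%:A *: (a *: (b *: v)).
Proof. by rewrite mulr1 scale_algl scalerA. Qed.

Lemma lspan_mem s v : v \in s -> lspan s v.
Proof.
move=> sv; have ltv : (index v s < size s)%N by rewrite index_mem.
exists (fun j => (j == index v s)%:R); rewrite (bigD1 (Ordinal ltv)) //= eqxx.
rewrite !scale1r nth_index // big1 ?addr0 // => j; rewrite -val_eqE /= => /negPf ->.
by rewrite !scale0r.
Qed.

Lemma ldim_ge V (d : nat) (b : 'I_d -> M) :
  (forall i, V (b i)) -> lin_indep b -> (d%:R%:E <= ldim V)%E.
Proof. by move=> Vb bI; apply: ereal_sup_ubound; exists d => //; exists b. Qed.

(** Each independent family is expressed in the spanning list by a matrix; a matrix with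
more rows than columns has a non-zero left kernel. *)
Lemma ldim_le V s : V `<=` lspan s -> (ldim V <= (size s)%:R%:E)%E.
Proof.
move=> Vs; apply: ge_ereal_sup => _ [d [b [Vb bI]] <-]; rewrite lee_fin ler_nat.
have [B bB] := choice (fun i => Vs _ (Vb i)).
pose X : 'M[R[i]]_(d, size s) := \matrix_(i, j) B i j.
rewrite leqNgt; apply/negP => lt_s_d.
have /rowV0Pn[x /sub_kermxP xX x0] : kermx X != 0.
  rewrite kermx_eq0 /row_free neq_ltn.
  by rewrite (leq_ltn_trans (rank_leq_col X) lt_s_d).
case/negP: x0; apply/eqP/rowP => i; rewrite mxE.
apply: (bI (x 0)); under eq_bigr => k _ do rewrite bB scaler_sumr.
rewrite exchange_big big1 //= => j _.
have := congr1 (fun Y : 'rV__ => Y 0 j) xX; rewrite !mxE => xX0.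
under eq_bigr => k _ do rewrite -algZA.
rewrite -scaler_suml -scaler_suml -[X in X%:A]/(\sum_k x 0 k * B k j).
rewrite (_ : \sum_k _ = 0) ?scale0r ?scale0r //.
by rewrite -[RHS]xX0; apply: eq_bigr => k _; rewrite mxE.
Qed.

(** Two vectors of [V] that are not proportional would form an independent family, and the
dimension would be at least two. *)
Lemma ldim1P V : ldim V = 1%E ->
  exists e, [/\ V e, e != 0 & forall v, V v -> exists c, v = c%:A *: e].
Proof.
move=> dV.
have indep1 e : V e -> e != 0 -> forall v, V v -> exists c, v = c%:A *: e.
  move=> Ve e0 v Vv; apply: contrapT => nv.
  suff: (2%:R%:E <= ldim V)%E by rewrite dV lee_fin lern1.
  apply: (@ldim_ge _ _ (fun i : 'I_2 => if i == 0 then e else v)).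
    by move=> i; case: ifP.
  move=> c; rewrite big_ord_recl big_ord1 /= => ce.
  have c1 : c (lift ord0 ord0) = 0.
    apply: contrapT => /eqP c1; apply: nv.
    exists (- ((c (lift ord0 ord0))^-1 * c ord0)).
    move/eqP: ce; rewrite addrC addr_eq0 => /eqP ce.
    by rewrite scaleNr scaleNr algZA -scalerN -ce algZK.
  move: ce; rewrite c1 scale0r scale0r addr0 => /(algZ_eq0 e0) c0 i.
  by case: (unliftP ord0 i) => [j ->|->//]; rewrite ord1.
apply: contrapT => nV.
suff: (ldim V <= 0)%E by rewrite dV lee_fin ler10.
apply: ge_ereal_sup => _ [[|d] [b [Vb bI]] <-] //.
case: nV; exists (b ord0); have b0 : b ord0 != 0.
  apply/eqP => b0; have /eqP := oner_neq0 R[i].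
  rewrite -[1](_ : (fun i : 'I_d.+1 => (i == ord0)%:R) ord0 = 1) //.
  case; apply: (bI (fun i => (i == ord0)%:R)).
  rewrite (bigD1 ord0) //= b0 scaler0 add0r big1 // => i /negPf ->.
  by rewrite !scale0r.
by split => //; exact: indep1.
Qed.

Lemma limn_esup_le (u : (\bar R)^nat) (x : \bar R) (N : nat) :
  (forall k, (N <= k)%N -> (u k <= x)%E) -> (limn_esup u <= x)%E.
Proof.
move=> ux; apply: (@le_trans _ _ (ereal_sup (u @` [set k | (N <= k)%N]))).
  by apply: ereal_inf_lbound; exists [set k | (N <= k)%N] => //; exists N.
by apply: ge_ereal_sup => _ [k /= Nk <-]; exact: ux.
Qed.

Lemma limn_esup_ge (u : (\bar R)^nat) (x : \bar R) (N : nat) :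
  (forall k, (N <= k)%N -> (x <= u k)%E) -> (x <= limn_esup u)%E.
Proof.
move=> ux; apply: le_ereal_inf_tmp => _ [V [m _ Vm] <-].
apply: (@le_trans _ _ (u (maxn m N))); first by rewrite ux ?leq_maxr.
by apply: ereal_sup_ubound; exists (maxn m N) => //; apply: Vm; rewrite /= leq_maxl.
Qed.

(** The dimensions of the filtration stay below [size s], so their logarithms are
negligible against [ln k]. *)
Lemma GKdim_finite s : (forall v, lspan s v) -> (GKdim M <= 0)%E.
Proof.
move=> Ms; apply: ge_ereal_sup => _ [[a t] _ <-] /=; apply/lee_addgt0Pr => e e0.
pose D : R := (size s).+1%:R.
have D1 : 1 <= D by rewrite ler1n.
have D0 : 0 < D by exact: lt_le_trans ltr01 D1.
pose N := Num.bound (expR (ln D / e)).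
(* From [2] on, [ln k] is positive; from [N] on, [ln D <= e * ln k]. *)
apply: (@limn_esup_le _ _ (maxn 2 N)) => k; rewrite geq_max => /andP[k2 Nk].
have lnk : 0 < ln (k%:R : R) by rewrite ln_gt0 // ltr1n.
have Dk : ln D <= e * ln k%:R.
  rewrite -ler_pdivrMl // mulrC -[leLHS]expRK ler_ln ?posrE ?expR_gt0 ?ltr0n ?(ltnW k2) //.
  rewrite (le_trans (ltW (archi_boundP (expR_ge0 _)))) // ler_nat //.
apply: (@le_trans _ _ ((ln D)%:E * (ln k%:R)^-1%:E)%E); last first.
  by rewrite add0e -EFinM lee_fin ler_pdivrMr.
apply: lee_wpmul2r; first by rewrite lee_fin invr_ge0 ltW.
rewrite -lne_EFin // -[X in (X <= _)%E]/(lne _).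
have dD : (ldim (lspan (gk_filtration a t k)) <= D%:E)%E.
  by apply: (le_trans (@ldim_le _ s _)) => [v _ //|]; rewrite lee_fin ler_nat.
(* The logarithm of the dimension of the zero space is [-oo]. *)
have [d0|d0] := leP (ldim (lspan (gk_filtration a t k))) 0%E.
  by rewrite (le0_lneNy d0) leNye.
by rewrite lee_lne // in_itv /= ?leey ?andbT ?(ltW d0) // lee_fin ltW.
Qed.

Lemma GKdim_ge1 (a : seq A) s :
  (forall k, (k.+1%:R%:E <= ldim (lspan (gk_filtration a s k)))%E) ->
  (1 <= GKdim M)%E.
Proof.
move=> dk; apply: le_trans (ereal_sup_ubound _); last by exists (a, s).
apply: (@limn_esup_ge _ _ 2) => k k2 /=.
have lnk : 0 < ln (k%:R : R) by rewrite ln_gt0 // ltr1n.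
rewrite lee_pdivlMr // mul1e -lne_EFin ?ltr0n ?(ltnW k2) // lee_lne.
- by apply: le_trans (dk k); rewrite lee_fin ler_nat.
- by rewrite in_itv /= leey lee_fin ler0n.
- by rewrite in_itv /= leey andbT (le_trans _ (dk k)) // lee_fin.
Qed.

End Dimension.

(** * Words in the generators *)

Section Words.
Variables (K : fieldType) (n : nat) (Q : 'M[K]_n.+1).
Local Notation word := (monalg.fmonom 'I_n.+1).
Local Notation monom w := (monalg.mkmalgU w 1 : free_alg K n).

Lemma monalg_mkmalgUZ (w : word) (c : K) :
  monalg.mkmalgU w c = c *: monom w :> free_alg K n.
Proof.
apply/monalg.malgP => v; apply: esym; apply: etrans (monalg.mcoeffZ _ _ _) _.
rewrite [in LHS]monalg.mcoeffU [RHS]monalg.mcoeffU.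
by rewrite mulrnAr mulr1.
Qed.

Lemma monomM (v w : word) : monom v * monom w = monom (monalg.mul v w).
Proof. by rewrite monalg.malgM_def monalg.fgmulUU mulr1. Qed.

Lemma free_algE (f : free_alg K n) :
  f = \sum_(w <- monalg.msupp f) monalg.mcoeff w f *: monom w.
Proof.
rewrite [LHS]monalg.monalgE; apply: eq_bigr => w _; exact: monalg_mkmalgUZ.
Qed.

Lemma free_algZl (c : K) (f g : free_alg K n) : (c *: f) * g = c *: (f * g).
Proof. by rewrite -scalerAl. Qed.

Lemma free_algZr (c : K) (f g : free_alg K n) : f * (c *: g) = c *: (f * g).
Proof. by rewrite -scalerAr. Qed.

Definition qword (w : seq 'I_n.+1) : qalg Q := \prod_(i <- w) qx Q i.

Lemma qword_cons i w : qword (i :: w) = qx Q i * qword w.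
Proof. exact: big_cons. Qed.

Lemma quot_proj_word (w : word) : quot_proj (qrel Q) (monom w) = qword w.
Proof.
case: w => w; elim: w => [|i w IHw].
  by rewrite /qword big_nil -monalg.fmoneE.
rewrite qword_cons -[X in _ * X]IHw -[qx Q i * _]quot_projM.
by rewrite /free_gen monomM /monalg.mul /= monalg.fmmulE monalg.fmuE.
Qed.

Lemma quot_projE (f : free_alg K n) : quot_proj (qrel Q) f =
  \sum_(w <- monalg.msupp f) monalg.mcoeff w f *: qword w :> qalg Q.
Proof.
rewrite {1}[f]free_algE.
apply: (big_ind2 (fun f a => quot_proj (qrel Q) f = a)) => [|f1 _ f2 _ <- <-|w _].
- by apply: (addrI (quot_proj (qrel Q) 0)); rewrite -quot_projD !addr0.
- exact: quot_projD.
by rewrite quot_projZ quot_proj_word.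
Qed.

Lemma qalg_wordE (a : qalg Q) :
  exists s : seq (K * seq 'I_n.+1), a = \sum_(t <- s) t.1 *: qword t.2.
Proof.
elim/quot_ind: a => f.
exists [seq (monalg.mcoeff w f, w : seq _) | w <- monalg.msupp f].
by rewrite big_map; exact: quot_projE.
Qed.

Lemma qdeg_word w : qdeg Q (size w) (qword w).
Proof.
exists (monom (monalg.FMonom w)); last by rewrite quot_proj_word.
move=> v; rewrite monalg.mcoeffU; case: (_ =P v) => [<- //|_].
by rewrite mulr0n eqxx.
Qed.

Lemma qxM i j : qx Q i * qx Q j = Q i j *: (qx Q j * qx Q i).
Proof.
rewrite -[qx Q i * _]quot_projM -[qx Q j * _]quot_projM.
rewrite -[RHS]quot_projZ; apply/quot_projP/asboolP.
exists [:: (1, (i, j), 1)]; rewrite big_seq1.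
by apply: esym; apply: etrans (mulr1 _) (mul1r _).
Qed.

End Words.

(** * The twisted polynomial modules *)

Section TwistedModule.
Variables (K : fieldType) (n : nat) (Q : 'M[K]_n.+1) (u r : 'I_n.+1 -> K).
Local Notation word := (monalg.fmonom 'I_n.+1).
Local Notation monom w := (monalg.mkmalgU w 1 : free_alg K n).

(** The operator by which [qx Q i] will act: it sends [p] to [u_i X p(r_i X)], so that
[X^k] goes to [u_i r_i^k X^(k+1)]. *)
Definition twist_op i (p : {poly K}) : {poly K} :=
  u i *: ('X * (p \Po (r i *: 'X))).

Lemma twist_op_linear i : linear (twist_op i).
Proof.
move=> c p q; rewrite /twist_op comp_polyD comp_polyZ mulrDr scalerDr.
by rewrite -scalerAr scalerA mulrC -scalerA.
Qed.

HB.instance Definition _ i :=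
  GRing.isLinear.Build K {poly K} {poly K} _ (twist_op i) (@twist_op_linear i).

Lemma twist_opXn i k : twist_op i 'X^k = (u i * r i ^+ k) *: 'X^(k.+1).
Proof.
by rewrite /twist_op comp_Xn_poly exprZn -scalerAr scalerA -exprS.
Qed.

Definition twist_word (w : seq 'I_n.+1) (p : {poly K}) : {poly K} :=
  foldr twist_op p w.

Lemma twist_word_linear w : linear (twist_word w).
Proof. by elim: w => [//|i w IHw] c p q /=; rewrite IHw linearP. Qed.

HB.instance Definition _ w :=
  GRing.isLinear.Build K {poly K} {poly K} _ (twist_word w) (@twist_word_linear w).

(** The free algebra acts through any family of operators. For a fixed [p] the action is
the additive extension of a function on words. *)
Definition free_act (f : free_alg K n) (p : {poly K}) : {poly K} :=
  monalg.mmap (@polyC K) (fun w : word => twist_word w p) f.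

Lemma free_actE f p : free_act f p =
  \sum_(w <- monalg.msupp f) monalg.mcoeff w f *: twist_word w p.
Proof. by apply: eq_bigr => w _; rewrite mul_polyC. Qed.

Lemma free_actB p : {morph free_act^~ p : f g / f - g}.
Proof. exact: raddfB. Qed.

Lemma free_act_sum p (I : Type) (s : seq I) (F : I -> free_alg K n) :
  free_act (\sum_(i <- s) F i) p = \sum_(i <- s) free_act (F i) p.
Proof. exact: raddf_sum. Qed.

Lemma free_actZ c f p : free_act (c *: f) p = c *: free_act f p.
Proof.
rewrite /free_act (monalg.mmapEw (monalg.msuppZ_le c f)) scaler_sumr.
apply: eq_bigr => w _; rewrite monalg.mcoeffZ !mul_polyC scalerA //.
Qed.

Lemma free_act_linear f : linear (free_act f).
Proof.
move=> c p q; rewrite !free_actE scaler_sumr -big_split; apply: eq_bigr => w _.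
by rewrite linearP scalerDr !scalerA mulrC.
Qed.

HB.instance Definition _ f :=
  GRing.isLinear.Build K {poly K} {poly K} _ (free_act f) (@free_act_linear f).

Lemma free_act_monom w p : free_act (monom w) p = twist_word w p.
Proof. by rewrite /free_act monalg.mmapU mul1r. Qed.

Lemma free_act_monomM v w p :
  free_act (monom v * monom w) p = twist_word v (twist_word w p).
Proof.
rewrite monomM free_act_monom /twist_word -foldr_cat.
congr foldr; exact: monalg.fmM.
Qed.

(** Both sides are bilinear in [f] and [g], and words act by composition. *)
Lemma free_actM f g p : free_act (f * g) p = free_act f (free_act g p).
Proof.
rewrite [f]free_algE mulr_suml !free_act_sum; apply: eq_bigr => v _.
apply: etrans (congr1 (free_act^~ p) (free_algZl _ _ _)) _.
apply: etrans (free_actZ _ _ _) (etrans _ (esym (free_actZ _ _ _))).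
congr (_ *: _); rewrite free_act_monom.
rewrite [g]free_algE mulr_sumr !free_act_sum linear_sum; apply: eq_bigr => w _.
apply: etrans (congr1 (free_act^~ p) (free_algZr _ _ _)) _.
apply: etrans (free_actZ _ _ _) _; rewrite free_act_monomM.
apply: etrans (esym (linearZ _ _)) _; congr twist_word.
by apply: etrans (esym (free_actZ _ _ _)); rewrite free_act_monom.
Qed.

Lemma free_act_gen i p : free_act (free_gen K i) p = twist_op i p.
Proof. by rewrite free_act_monom /twist_word monalg.fmU. Qed.

(** With [twist_opM] below, this is exactly what makes the defining relations of [qalg Q]
act by zero. *)
Hypothesis u_r : forall i j, u i * u j * (r i - Q i j * r j) = 0.

Lemma twist_opM i j p : twist_op i (twist_op j p) =
  (u i * u j * r i) *: ('X^2 * (p \Po ((r i * r j) *: 'X))).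
Proof.
rewrite /twist_op comp_polyZ comp_polyM comp_polyX -comp_polyA comp_polyZ.
rewrite comp_polyX scalerA (mulrC (r j)) -!scalerAl -!scalerAr !scalerA mulrA.
by rewrite mulrA -expr2.
Qed.

Lemma free_act_qrel ij p : free_act (qrel Q ij) p = 0.
Proof.
case: ij => i j; apply: etrans (free_actB _ _ _) _.
apply: etrans (congr2 (fun f g => f - g) (free_actM _ _ _)
  (etrans (free_actZ _ _ _) (congr1 _ (free_actM _ _ _)))) _.
rewrite !free_act_gen /= !twist_opM (mulrC (r j)) scalerA -scalerBl.
by rewrite (_ : _ - _ = 0) ?scale0r // -[RHS](u_r i j); ring.
Qed.

Lemma free_act_ideal f p : f \in gen_ideal (qrel Q) -> free_act f p = 0.
Proof.
move=> /asboolP[s ->]; rewrite free_act_sum big1 // => t _.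
by rewrite !free_actM free_act_qrel linear0.
Qed.

(** The polynomial ring as a [qalg Q]-module; the compatibility condition [u_r] is an
argument of the type because the module laws depend on it. *)
Definition twisted_poly of (forall i j, u i * u j * (r i - Q i j * r j) = 0) : Type :=
  {poly K}.
Local Notation P := (twisted_poly u_r).
HB.instance Definition _ := GRing.Zmodule.on P.

Definition twisted_scale (a : qalg Q) (p : P) : P := free_act (repr a) p.

Lemma twisted_scale_proj f p : twisted_scale (quot_proj (qrel Q) f) p = free_act f p.
Proof.
apply/eqP; rewrite -subr_eq0 -free_actB; apply/eqP/free_act_ideal/quot_projP.
by rewrite quot_reprK.
Qed.

Lemma twisted_scaleA a b p :
  twisted_scale a (twisted_scale b p) = twisted_scale (a * b) p.
Proof.
elim/quot_ind: a => f; elim/quot_ind: b => g.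
apply: etrans (congr1 _ (twisted_scale_proj _ _)) _.
apply: etrans (twisted_scale_proj _ _) (etrans (esym (free_actM _ _ _)) _).
by rewrite -twisted_scale_proj quot_projM.
Qed.

Lemma twisted_scale1 : left_id 1 twisted_scale.
Proof.
move=> p; rewrite [LHS]twisted_scale_proj (free_act_monom monalg.one).
by rewrite /twist_word monalg.fm1.
Qed.

Lemma twisted_scaleDr : right_distributive twisted_scale +%R.
Proof. by move=> a p q; exact: linearD. Qed.

Lemma twisted_scaleDl p : {morph twisted_scale^~ p : a b / a + b}.
Proof.
elim/quot_ind => f; elim/quot_ind => g; rewrite -quot_projD.
apply: etrans (twisted_scale_proj _ _) _.
apply: etrans (esym (congr2 _ (twisted_scale_proj _ _) (twisted_scale_proj _ _))).
exact: raddfD.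
Qed.

HB.instance Definition _ := GRing.Zmodule_isLmodule.Build (qalg Q) P
  twisted_scaleA twisted_scale1 twisted_scaleDr twisted_scaleDl.

Lemma twisted_algZ c (p : P) : (c%:A : qalg Q) *: p = c *: (p : {poly K}) :> {poly K}.
Proof.
have -> : c%:A = (quot_proj (qrel Q) (c *: 1) : qalg Q) by exact: esym (quot_projZ _ _ _).
apply: etrans (twisted_scale_proj _ _) (etrans (free_actZ _ _ _) _).
by rewrite (free_act_monom monalg.one) /twist_word monalg.fm1.
Qed.

Lemma twisted_scaleZ c (a : qalg Q) (p : P) :
  (c *: a) *: p = c *: (a *: p : {poly K}) :> {poly K}.
Proof.
have -> : c *: a = c%:A * a by rewrite -scalerAl mul1r.
by rewrite -twisted_algZ scalerA.
Qed.

Lemma twisted_qx i (p : P) : qx Q i *: p = twist_op i p :> {poly K}.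
Proof. by apply: etrans (twisted_scale_proj _ _) _; rewrite free_act_gen. Qed.

End TwistedModule.

(** * Twisted polynomial modules are point modules *)

Lemma coef_sumZXn (K : nzRingType) (c : nat -> K) (N i : nat) : (i < N)%N ->
  (\sum_(j < N) c j *: 'X^j)`_i = c i.
Proof. by move=> ltiN; rewrite -poly_def coef_poly ltiN. Qed.

Section TwistedPointModule.
Variables (R : realType) (n : nat) (Q : 'M[R[i]]_n.+1) (u r : 'I_n.+1 -> R[i]).
Hypothesis u_r : forall i j, u i * u j * (r i - Q i j * r j) = 0.
Variable o : 'I_n.+1.
Hypotheses (uo : u o != 0) (ro : r o != 0).
Local Notation P := (twisted_poly u_r).
Local Notation A := (qalg Q).

Definition twisted_gr (i : nat) : set P :=
  [set p | exists c, p = c *: 'X^i :> {poly R[i]}].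

Lemma size_twist_op p : p != 0 -> size (twist_op u r o p) = (size p).+1.
Proof.
move=> p0; rewrite /twist_op size_scale // mulrC size_mulX; last first.
  by rewrite -size_poly_eq0 size_comp_poly2 ?size_poly_eq0 // size_scale // size_polyX.
by rewrite size_comp_poly2 // size_scale // size_polyX.
Qed.

(** The generator [qx Q o] alone moves along the whole grading. *)
Lemma twisted_qxXE k :
  exists c, c != 0 /\ (qx Q o ^+ k *: (1 : P)) = c *: 'X^k :> {poly R[i]}.
Proof.
elim: k => [|k [c [c0 IHk]]].
  by exists 1; rewrite oner_neq0 expr0 !scale1r.
exists (c * (u o * r o ^+ k)); split; first by rewrite !mulf_neq0 ?expf_neq0.
by rewrite exprS -scalerA twisted_qx IHk linearZ /= twist_opXn scalerA.
Qed.

Lemma twisted_cyclic (p : P) : exists a : A, p = a *: (1 : P).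
Proof.
have [c cP] := choice twisted_qxXE.
exists (\sum_(k < size (p : {poly R[i]})) (p`_k / c k)%:A * qx Q o ^+ k).
rewrite scaler_suml -[LHS](coefK (p : {poly R[i]})) poly_def.
apply: eq_bigr => k _; have [c0 cX] := cP k.
have -> a b : (a%:A * b) *: (1 : P) = a%:A *: (b *: (1 : P)) by rewrite scalerA.
by rewrite twisted_algZ cX scalerA divfK.
Qed.

Lemma twist_wordXn w k : exists c, twist_word u r w 'X^k = c *: 'X^(size w + k).
Proof.
elim: w => [|i w [c IHw]] /=; first by exists 1; rewrite scale1r.
by exists (c * (u i * r i ^+ (size w + k))); rewrite IHw linearZ /= twist_opXn scalerA.
Qed.

Lemma twisted_graded : graded_module twisted_gr.
Proof.
split=> [i|v|N v grv v0 i ltiN|d i a v [f fd ->] [c ->]].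
- split; first by exists 0; rewrite scale0r.
  move=> c p q [a ->] [b ->]; exists (c * a + b).
  rewrite twisted_algZ scalerA; exact: esym (scalerDl _ _ _).
- exists (size (v : {poly R[i]})), (fun i => v`_i *: 'X^i : {poly R[i]}).
  by split=> [i|]; [exists v`_i|rewrite -[LHS](coefK (v : {poly R[i]})) poly_def].
- have [c cX] := choice grv.
  have {}v0 : \sum_(j < N) c j *: 'X^j = 0 :> {poly R[i]}.
    by rewrite -[RHS]v0; apply: eq_bigr.
  by rewrite cX -[c i](coef_sumZXn c ltiN) v0 coef0 scale0r.
have fE : (quot_proj (qrel Q) f : A) *: (c *: 'X^i : P) = free_act u r f (c *: 'X^i).
  exact: twisted_scale_proj.
rewrite /twisted_gr /= fE free_actE.
have /choice[g gE] (w : monalg.fmonom 'I_n.+1) :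
    exists b, monalg.mcoeff w f *: twist_word u r w (c *: 'X^i) = b *: 'X^(d + i).
  have [->|/fd <-] := eqVneq (monalg.mcoeff w f) 0.
    by exists 0; rewrite !scale0r.
  have [b wX] := twist_wordXn w i.
  by exists (monalg.mcoeff w f * (c * b)); rewrite linearZ /= wX !scalerA mulrA.
by exists (\sum_(w <- monalg.msupp f) g w); rewrite scaler_suml; apply: eq_bigr.
Qed.

Lemma ldim_twisted_gr k : ldim (twisted_gr k) = 1%E.
Proof.
apply/eqP; rewrite eq_le; apply/andP; split.
  apply: (@ldim_le _ _ _ _ [:: ('X^k : P)]) => p [c ->]; exists (fun=> c).
  by rewrite big_ord1 /= twisted_algZ.
apply: (@ldim_ge _ _ _ _ 1 (fun=> ('X^k : P))) => [_|c].
  by exists 1; rewrite scale1r.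
rewrite big_ord1 twisted_algZ => /eqP; rewrite scaler_eq0 -size_poly_eq0 size_polyXn.
by rewrite orbF => /eqP c0 i; rewrite ord1.
Qed.

(** The monomials of degree at most [k] are reached from [1] by [k] steps of [qx Q o]. *)
Lemma GKdim_twisted_ge1 : (1 <= GKdim P)%E.
Proof.
apply: (@GKdim_ge1 _ _ _ [:: qx Q o] [:: (1 : P)]) => k.
have [c cP] := choice twisted_qxXE.
apply: (@ldim_ge _ _ _ _ _ (fun i : 'I_k.+1 => qx Q o ^+ i *: (1 : P))) => [i|g].
  apply: lspan_mem; have: (i <= k)%N by rewrite -ltnS.
  move: {i}(i : nat); elim: k => [|k IHk] i /=.
    by rewrite leqn0 => /eqP ->; rewrite expr0 scale1r mem_seq1.
  rewrite leq_eqVlt mem_cat => /predU1P[->|/IHk -> //]; apply/orP; right.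
  rewrite cats0; apply/mapP; exists (qx Q o ^+ k *: (1 : P)); first exact: IHk.
  by rewrite exprS scalerA.
move=> g0 i; have [ci0 _] := cP i.
have {}g0 : \sum_(j < k.+1) (g (inord j) * c j) *: 'X^j = 0 :> {poly R[i]}.
  rewrite -[RHS]g0; apply: eq_bigr => j _.
  by rewrite twisted_algZ (cP j).2 scalerA inord_val.
have := coef_sumZXn (fun j => g (inord j) * c j) (ltn_ord i).
rewrite g0 coef0 inord_val => /esym/eqP.
by rewrite mulf_eq0 (negPf ci0) orbF => /eqP.
Qed.

(** A quotient by a non-zero submodule is finite-dimensional: if [p] of degree [d] is
killed, so are the multiples [qx Q o ^+ m *: p], which realise every degree from [d] on,
hence everything reduces to polynomials of degree less than [d]. *)
Lemma twisted_critical : critical P.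
Proof.
move=> M f f_surj f_ninj; apply: (@le_lt_trans _ _ 0%E); last first.
  exact: lt_le_trans lte01 GKdim_twisted_ge1.
have [p p0 fp0] : exists2 p : P, p != 0 & f p = 0.
  apply: contrapT => np; apply: f_ninj => a b fab; apply/eqP; rewrite -subr_eq0.
  apply: contrapT => /negP ab; apply: np; exists (a - b) => //.
  by rewrite linearB fab subrr.
pose d := (size (p : {poly R[i]})).-1.
have sp : size (p : {poly R[i]}) = d.+1 by rewrite prednK // size_poly_gt0.
have fX k : (d < k)%N -> exists2 q : P, f q = 0 & size (q : {poly R[i]}) = k.
  elim: k => // k IHk; rewrite ltnS leq_eqVlt => /predU1P[<-|dk]; first by exists p.
  have [q fq sq] := IHk dk; exists (qx Q o *: q); first by rewrite linearZ /= fq scaler0.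
  by rewrite twisted_qx size_twist_op ?sq // -size_poly_gt0 sq (leq_ltn_trans _ dk).
(* Subtracting a killed element with the same leading term lowers the degree. *)
have f_red k : forall v : P, (size (v : {poly R[i]}) <= k)%N ->
    exists2 q : P, f q = f v & (size (q : {poly R[i]}) <= d)%N.
  elim: k => [|k IHk] v sv; first by exists v => //; exact: leq_trans sv _.
  have [vd|dv] := leqP (size (v : {poly R[i]})) d; first by exists v.
  have [q fq sq] := fX _ dv; pose c : R[i] := lead_coef v / lead_coef q.
  have [|t ft st] := IHk (v - c%:A *: q).
    rewrite twisted_algZ; apply/leq_sizeP => j kj.
    rewrite coefD coefN coefZ; have [vj|jv] := leqP (size (v : {poly R[i]})) j.
      by rewrite !nth_default ?sq // mulr0 subr0.
    have jE : j = (size (v : {poly R[i]})).-1.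
      by apply/eqP; rewrite eqn_leq -ltnS prednK ?(leq_ltn_trans _ jv) ?jv // -ltnS
        prednK ?(leq_ltn_trans _ jv) // (leq_trans sv).
    rewrite jE -[in X in _ * X]sq -!lead_coefE divfK ?subrr // lead_coef_eq0.
    by rewrite -size_poly_gt0 sq (leq_ltn_trans _ jv).
  by exists t => //; rewrite ft linearB linearZ /= fq scaler0 subr0.
apply: (@GKdim_finite _ _ _ [seq f ('X^k : P) | k <- iota 0 d]) => v.
have [w <-] := f_surj v; have [q <- sq] := f_red _ w (leqnn _).
exists (fun k => (q : {poly R[i]})`_k); rewrite size_map size_iota.
have qE : q = \sum_(k < d) (q : {poly R[i]})`_k *: 'X^k :> {poly R[i]}.
  apply/polyP => k; rewrite -poly_def coef_poly; case: ltnP => // dk.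
  by rewrite nth_default ?(leq_trans sq).
have {1}-> : q = \sum_(k < d) ((q : {poly R[i]})`_k)%:A *: ('X^k : P).
  by apply: etrans qE _; apply: eq_bigr => k _; rewrite twisted_algZ.
rewrite linear_sum; apply: eq_bigr => k _.
by rewrite linearZ (nth_map 0%N) ?size_iota // nth_iota.
Qed.

Lemma twisted_point_module : point_module twisted_gr.
Proof.
split; first exact: twisted_graded.
- exists (1 : P); last exact: twisted_cyclic.
  by exists 1; rewrite scale1r.
- exact: twisted_critical.
exact: ldim_twisted_gr.
Qed.

End TwistedPointModule.

(** * Points and the linear forms vanishing at them *)

Section ProjectivePoints.
Variables (K : fieldType) (n : nat).
Implicit Types (u v : 'rV[K]_n.+1) (p q : proj_space K n).

Lemma proj_space_inj p q : pline p = pline q -> p = q.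
Proof.
case: p q => [L dL] [L' dL'] /= e; subst L'; congr exist.
exact: bool_irrelevance.
Qed.

Lemma dim_line u : u != 0 -> \dim <[u]>%VS == 1%N.
Proof. by rewrite dim_vline => ->. Qed.

Definition proj_point u (u0 : u != 0) : proj_space K n := exist _ <[u]>%VS (dim_line u0).

Lemma pline_point u (u0 : u != 0) : pline (proj_point u0) = <[u]>%VS.
Proof. by []. Qed.

Lemma plineP p : exists2 u, u != 0 & pline p = <[u]>%VS.
Proof.
case: p => L /= dL; exists (vpick L).
  by rewrite vpick0 -dimv_eq0 (eqP dL).
apply/esym/eqP; rewrite eqEdim -memvE memv_pick dim_vline vpick0 -dimv_eq0 (eqP dL) //.
Qed.

Lemma mem_pline p u : pline p = <[u]>%VS -> u \in pline p.
Proof. by move=> ->; exact: memv_line. Qed.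

End ProjectivePoints.

Section LinearForms.
Variables (K : fieldType) (n : nat) (u : 'rV[K]_n.+1).

Lemma row_basis_of (m p k : nat) (X : 'M[K]_(m, p)) : \rank X = k ->
  exists c : 'M[K]_(k, p), row_free c /\ (c :=: X)%MS.
Proof.
by move=> <-; exists (row_base X); rewrite row_base_free; split; last exact: eq_row_base.
Qed.

Lemma forms_at : u != 0 -> exists c : 'M[K]_(n, n.+1),
  [/\ row_free c, c *m u^T = 0 & forall a : 'rV_n.+1, a *m u^T = 0 -> (a <= c)%MS].
Proof.
move=> u0; have rk : \rank (kermx u^T) = n.
  by rewrite mxrank_ker mxrank_tr rank_rV u0 subSS subn0.
have [c [cF cE]] := row_basis_of rk; exists c; split=> // [|a a0].
  by apply/sub_kermxP; rewrite cE.
by rewrite cE; apply/sub_kermxP.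
Qed.

(** The forms [u_i x_j - u_j x_i], all in the row space of [c], already cut out the point. *)
Lemma forms_at_line (c : 'M[K]_(n, n.+1)) (x : 'rV_n.+1) : u != 0 ->
  (forall a : 'rV_n.+1, a *m u^T = 0 -> (a <= c)%MS) -> c *m x^T = 0 -> x \in <[u]>%VS.
Proof.
move=> /rV0Pn[i ui] c_gen cx; apply/vlineP; exists (x 0 i / u 0 i).
apply/rowP => j; rewrite mxE mulrAC.
(* The form [u_i x_j - u_j x_i]. *)
pose a : 'rV[K]_n.+1 := u 0 i *: delta_mx 0 j - u 0 j *: delta_mx 0 i.
have aE (y : 'rV[K]_n.+1) : (a *m y^T) 0 0 = u 0 i * y 0 j - u 0 j * y 0 i.
  by rewrite mulmxBl -!scalemxAl -!rowE !mxE.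
have /submxP[b ab] : (a <= c)%MS.
  by apply: c_gen; apply/matrixP => k k'; rewrite !ord1 aE mulrC subrr mxE.
have := aE x; rewrite ab -mulmxA cx mulmx0 mxE => /esym/eqP; rewrite subr_eq0.
by move=> /eqP e; rewrite (mulrC (x 0 i)) -e mulrC mulKf.
Qed.

End LinearForms.

(** * The left ideal of the forms vanishing at a point *)

Section QCommutation.
Variables (K : fieldType) (A : algType K).
Implicit Types (x y z : A) (c d : K).

Lemma qcomm_exp c x y k : y * x = c *: (x * y) ->
  y * x ^+ k = c ^+ k *: (x ^+ k * y).
Proof.
move=> yx; elim: k => [|k IHk]; first by rewrite !expr0 mul1r mulr1 scale1r.
rewrite [x ^+ _]exprS mulrA yx -scalerAl -(mulrA x y) IHk -scalerAr scalerA.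
by rewrite [c ^+ k.+1]exprS (mulrA x).
Qed.

(** The inductive step of [forms_ideal_word], with [x] a power of [qx Q o], [w] a word,
[y] its new first letter and [z = qx Q o]. *)
Lemma qcomm_reduce c d e x y z w : y * x = c *: (x * y) ->
  y * w - (d * (c * e)) *: (x * z) =
  y * (w - d *: x) + (d *: (c *: x)) * (y - e *: z).
Proof.
move=> yx; rewrite !mulrBr -!scalerAl -!scalerAr yx addrA subrK.
by rewrite !scalerA mulrA.
Qed.

(** The step of [forms_ideal_poly] that adds a word [w] to a linear combination [z]. *)
Lemma sub_reduce d e x y w z :
  d *: w + z - ((d * e) *: x + y) = d%:A * (w - e *: x) + (z - y).
Proof. by rewrite mulr_algl scalerBr scalerA opprD addrACA. Qed.

End QCommutation.

Section LeftIdeal.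
Variables (K : fieldType) (n : nat) (Q : 'M[K]_n.+1).
Local Notation A := (qalg Q).

Definition qform (a : 'rV[K]_n.+1) : A := \sum_i a 0 i *: qx Q i.

Lemma qform_linear : linear qform.
Proof.
move=> c a b; rewrite scaler_sumr -big_split; apply: eq_bigr => i _.
by rewrite !mxE scalerDl scalerA.
Qed.
HB.instance Definition _ :=
  GRing.isLinear.Build K 'rV[K]_n.+1 A _ qform qform_linear.

(** For the [j]-th coordinate point, twisted polynomials form a module as soon as the
diagonal of [Q] is [1]; acting on [1] there, a form returns its [j]-th coefficient. *)
Lemma qform_inj : (forall i, Q i i = 1) -> injective qform.
Proof.
move=> Q1; apply: raddf_inj => a a0; apply/rowP => j; rewrite mxE.
pose u i : K := (i == j)%:R.
have u_r i k : u i * u k * (1 - Q i k * 1) = 0.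
  rewrite /u; case: eqP => [->|_]; case: eqP => [->|_]; rewrite ?mul0r ?mulr0 ?mul0r //.
  by rewrite Q1 mulr1 subrr mulr0.
have := congr1 (fun x : A => x *: (1 : twisted_poly u_r)) a0.
rewrite scale0r scaler_suml.
under eq_bigr => i _ do rewrite twisted_scaleZ twisted_qx.
move=> /(congr1 (fun p : {poly K} => p`_1)).
rewrite (coef_sum _ _ (fun i => a 0 i *: twist_op u (fun=> 1) i 1)) coef0.
rewrite (bigD1 j) //= -(expr0 'X) twist_opXn !coefZ coefXn /u eqxx expr1n !mulr1.
rewrite big1 ?addr0 // => i /negPf ij.
by rewrite twist_opXn !coefZ ij !mul0r mulr0.
Qed.

Variables (u : 'rV[K]_n.+1) (o : 'I_n.+1) (c : 'M[K]_(n, n.+1)).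
Hypotheses (uo : u 0 o != 0)
  (c_gen : forall a : 'rV_n.+1, a *m u^T = 0 -> (a <= c)%MS).

Definition forms_ideal (a : A) : Prop :=
  exists b : 'I_n -> A, a = \sum_m b m * qform (row m c).

Lemma forms_ideal0 : forms_ideal 0.
Proof. by exists (fun=> 0); rewrite big1 // => m _; rewrite mul0r. Qed.

Lemma forms_idealD a b : forms_ideal a -> forms_ideal b -> forms_ideal (a + b).
Proof.
move=> [s ->] [t ->]; exists (fun m => s m + t m).
by rewrite -big_split; apply: eq_bigr => m _; rewrite mulrDl.
Qed.

Lemma forms_idealM a b : forms_ideal b -> forms_ideal (a * b).
Proof.
move=> [t ->]; exists (fun m => a * t m).
by rewrite mulr_sumr; apply: eq_bigr => m _; rewrite mulrA.
Qed.

Lemma forms_ideal_form (a : 'rV_n.+1) : a *m u^T = 0 -> forms_ideal (qform a).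
Proof.
move=> /c_gen/submxP[b ->]; exists (fun m => (b 0 m)%:A).
rewrite mulmx_sum_row linear_sum; apply: eq_bigr => m _.
by rewrite linearZ /= -scalerAl mul1r.
Qed.

(** Modulo the left ideal of the forms vanishing at [u], every word is a multiple of a
power of [qx Q o]. To add a letter [x_i] on the left of [x_o^k], commute it through to the
right, where it may be replaced by [(u_i / u_o) x_o]. The quotient by that ideal is thus at
most one-dimensional in each degree. *)
Lemma forms_ideal_word w : exists d : K,
  forms_ideal (qword Q w - d *: qx Q o ^+ size w).
Proof.
elim: w => [|i w [d IHw]].
  by exists 1; rewrite /qword big_nil expr0 scale1r subrr; exact: forms_ideal0.
have xi : forms_ideal (qx Q i - (u 0 i / u 0 o) *: qx Q o).
  have -> : qx Q i - (u 0 i / u 0 o) *: qx Q o =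
      qform (delta_mx 0 i - (u 0 i / u 0 o) *: delta_mx 0 o).
    have qd j : qform (delta_mx 0 j) = qx Q j.
      rewrite /qform (bigD1 j) //= mxE !eqxx scale1r big1 ?addr0 // => k /negPf kj.
      by rewrite mxE kj andbF scale0r.
    by rewrite [qform _]linearB /= [qform (_ *: _)]linearZ /= !qd.
  apply: forms_ideal_form; apply/matrixP => k k'; rewrite !ord1.
  by rewrite mulmxBl -scalemxAl -!rowE !mxE divfK // subrr.
exists (d * (Q i o ^+ size w * (u 0 i / u 0 o))).
rewrite qword_cons exprSr (qcomm_reduce _ _ _ _ (qcomm_exp _ (qxM Q i o))).
apply: forms_idealD; apply: forms_idealM; [exact: IHw|exact: xi].
Qed.

Lemma forms_ideal_poly (a : A) : exists q : {poly K},
  forms_ideal (a - \sum_(k < size q) q`_k *: qx Q o ^+ k).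
Proof.
suff [q qa] : exists q : {poly K}, forms_ideal (a - horner_alg (qx Q o) q).
  exists q; move: qa; rewrite -{1}[q]coefK poly_def linear_sum.
  under eq_bigr => k _ do rewrite linearZ /= rmorphXn /= horner_algX mulr_algl.
  by [].
have [s ->] := qalg_wordE a; elim: s => [|t s [q IHs]].
  by exists 0; rewrite big_nil linear0 subr0; exact: forms_ideal0.
have [e we] := forms_ideal_word t.2; exists ((t.1 * e) *: 'X^(size t.2) + q).
have -> : horner_alg (qx Q o) ((t.1 * e) *: 'X^(size t.2) + q) =
    (t.1 * e) *: qx Q o ^+ size t.2 + horner_alg (qx Q o) q.
  by rewrite linearD linearZ /= rmorphXn /= horner_algX mulr_algl.
rewrite big_cons sub_reduce.
by apply: forms_idealD IHs; apply: forms_idealM we.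
Qed.

End LeftIdeal.

(** * Sufficiency: the module of a consistent point *)

Section ZeroLocusOfForms.
Variables (K : fieldType) (n : nat) (c : 'M[K]_(n, n.+1)).
Implicit Types (v : 'rV[K]_n.+1).

Lemma meval_form m v :
  mpoly.meval (fun i => v 0 i) (\sum_i c m i *: (ucoord i : coord_ring K n)) =
  (c *m v^T) m 0.
Proof.
rewrite raddf_sum mxE; apply: eq_bigr => i _ /=.
by rewrite mpoly.mevalZ mpoly.mevalXU mxE.
Qed.

Lemma zero_locus_forms (p : proj_space K n) (u : 'rV_n.+1) : pline p = <[u]>%VS ->
  c *m u^T = 0 -> (forall v, c *m v^T = 0 -> v \in <[u]>%VS) ->
  zero_locus [set \sum_i c m i *: (ucoord i : coord_ring K n) | m in [set: 'I_n]] = [set p].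
Proof.
move=> pu cu c_ker; apply/seteqP; split=> q /= => [q0|-> _ [m _ <-] v].
  have [v v0 qv] := plineP q; apply: proj_space_inj; apply/eqP.
  rewrite qv pu eqEdim -memvE !dim_vline v0 c_ker ?leq_b1 //.
  apply/matrixP => m j; rewrite ord1 -meval_form mxE.
  by apply: q0 => //; rewrite qv memv_line.
rewrite pu => /vlineP[a ->] _; rewrite meval_form linearZ /= -scalemxAr cu.
by rewrite scaler0 mxE.
Qed.

End ZeroLocusOfForms.

Section Sufficiency.
Variables (R : realType) (n : nat) (Q : 'M[R[i]]_n.+1).
Hypothesis hQ : quantum_matrix Q.
Variables (u : 'rV[R[i]]_n.+1) (o : 'I_n.+1).
Hypothesis uo : u 0 o != 0.
Hypothesis u_r : forall i j, u 0 i * u 0 j * (Q i o - Q i j * Q j o) = 0.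
Local Notation A := (qalg Q).
Local Notation P := (twisted_poly u_r).

Let ro : Q o o != 0. Proof. by have [Q0 _ _] := hQ. Qed.

(** The surjection presenting the twisted module as a cyclic one, with generator [1]. *)
Definition orbit_map (a : A^o) : P := a *: (1 : P).

Lemma orbit_map_linear : linear orbit_map.
Proof. by move=> b a a'; rewrite /orbit_map scalerDl -scalerA. Qed.
HB.instance Definition _ := GRing.isLinear.Build A A^o P _ orbit_map orbit_map_linear.

Lemma orbit_map1 : orbit_map 1 = (1 : P).
Proof. exact: (@scale1r A P). Qed.

Lemma orbit_map_form (a : 'rV_n.+1) : a *m u^T = 0 -> qform Q a *: (1 : P) = 0.
Proof.
move=> au; rewrite scaler_suml.
under eq_bigr => i _ do
  rewrite twisted_scaleZ twisted_qx -(expr0 'X) twist_opXn scalerA expr0 mulr1.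
have au0 : \sum_i a 0 i * u 0 i = 0.
  transitivity ((a *m u^T) 0 0); last by rewrite au mxE.
  by rewrite mxE; apply: eq_bigr => i _; rewrite mxE.
transitivity ((\sum_i a 0 i * u 0 i) *: 'X^1 : {poly R[i]}).
  by rewrite scaler_suml.
by rewrite au0 scale0r.
Qed.

(** Powers of [qx Q o] take [1] to non-zero multiples of distinct monomials. *)
Lemma orbit_map_poly (q : {poly R[i]}) :
  (\sum_(k < size q) q`_k *: qx Q o ^+ k) *: (1 : P) = 0 -> q = 0.
Proof.
have [c cP] := choice (twisted_qxXE u_r uo ro).
move=> q0; have {}q0 : \sum_(k < size q) (q`_k * c k) *: 'X^k = 0 :> {poly R[i]}.
  rewrite -[RHS]q0 scaler_suml; apply: eq_bigr => k _.
  by rewrite twisted_scaleZ (cP k).2 scalerA.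
apply/polyP => k; rewrite coef0; have [kq|] := ltnP k (size q); last exact: nth_default.
have := coef_sumZXn (fun k => q`_k * c k) kq; rewrite q0 coef0 => /esym/eqP.
by rewrite mulf_eq0 (negPf (cP k).1) orbF => /eqP.
Qed.

(** The annihilator of [1] is no larger than the left ideal of the forms vanishing at [u]:
modulo that ideal an element is a polynomial in [qx Q o], and such a polynomial kills [1]
only if it is zero. *)
Lemma twisted_associated (p : proj_space R[i] n) : pline p = <[u]>%VS ->
  associated_point (@twisted_gr _ _ _ _ _ u_r) p.
Proof.
move=> pu; have u0 : u != 0 by apply/rV0Pn; exists o.
have [c [cF cu c_gen]] := forms_at u0.
have lE m : \sum_i c m i *: qx Q i = qform Q (row m c).
  by apply: eq_bigr => i _; rewrite mxE.
have orbit0 b : orbit_map (\sum_m b m * qform Q (row m c)) = 0.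
  rewrite linear_sum big1 // => m _; apply: etrans (esym (scalerA _ _ _)) _.
  by rewrite orbit_map_form ?scaler0 // -row_mul cu row0.
have lsum (b : 'I_n -> A) : \sum_m b m * (\sum_i c m i *: qx Q i) =
    \sum_m b m * qform Q (row m c) by apply: eq_bigr => m _; rewrite lE.
exists c, orbit_map; split.
- move=> t t0; suff : (\row_m t m) = 0.
    by move=> /rowP tE m; have := tE m; rewrite !mxE.
  apply: (row_free_inj cF); rewrite mul0mx.
  have [_ Q1 _] := hQ; apply: (qform_inj Q1); rewrite linear0 -[RHS]t0.
  rewrite mulmx_sum_row linear_sum; apply: eq_bigr => m _.
  rewrite [LHS]linearZ /= mxE lE; exact: esym (mulr_algl _ _).
- by exists 1; apply: etrans orbit_map1 _; rewrite scale1r.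
- move=> v; have [a va] := @twisted_cyclic _ _ _ _ _ u_r o uo ro v.
  by exists a; exact: esym va.
- move=> a; split=> [a0|[b ab]].
    have [q [b ab]] := forms_ideal_poly uo c_gen a.
    have fb : orbit_map (\sum_m b m * qform Q (row m c)) = 0 by exact: orbit0.
    exists b; apply: etrans (esym (lsum b)); rewrite -ab.
    suff -> : q = 0 by rewrite size_poly0 big_ord0 subr0.
    apply: orbit_map_poly.
    by move: fb; rewrite -ab linearB /= a0 sub0r => /eqP; rewrite oppr_eq0 => /eqP.
  by rewrite (etrans ab (lsum b)); exact: orbit0.
apply: (zero_locus_forms pu cu) => v; exact: forms_at_line.
Qed.

Lemma mem_pts_of_twist (p : proj_space R[i] n) : pline p = <[u]>%VS -> pts Q p.
Proof.
move=> pu; exists P, (@twisted_gr _ _ _ _ _ u_r); split.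
  exact: (@twisted_point_module _ _ _ _ _ u_r o uo ro).
exact: twisted_associated.
Qed.

End Sufficiency.

(** * Necessity: the relations in degree two *)

Lemma sum_deltaM (A : nzRingType) (m : nat) (l : 'I_m -> A) k :
  l k = \sum_j (j == k)%:R * l j.
Proof.
by rewrite (bigD1 k) //= eqxx mul1r big1 ?addr0 // => j /negPf ->; rewrite mul0r.
Qed.

Section GradedModule.
Variables (R : realType) (n : nat) (Q : 'M[R[i]]_n.+1).
Variables (P : lmodType (qalg Q)) (gr : nat -> set P).
Hypothesis grP : graded_module gr.

Lemma graded_scale k c v : gr k v -> gr k (c%:A *: v).
Proof.
move=> gv; have [/(_ k)[g0 gD] _ _ _] := grP.
by rewrite -[_ *: v]addr0; apply: gD.
Qed.

Lemma graded_sum k (I : Type) (s : seq I) (p : pred I) (F : I -> P) :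
  (forall i, p i -> gr k (F i)) -> gr k (\sum_(i <- s | p i) F i).
Proof.
move=> gF; have [/(_ k)[g0 gD] _ _ _] := grP.
apply: big_ind => // u v gu gv; by have := gD 1 _ _ gu gv; rewrite !scale1r.
Qed.

(** By uniqueness of homogeneous components, a homogeneous sum of homogeneous terms is
the sum of those of its own degree. *)
Lemma graded_component k (I : eqType) (s : seq I) (deg : I -> nat) (F : I -> P) :
  (forall i, gr (deg i) (F i)) -> gr k (\sum_(i <- s) F i) ->
  \sum_(i <- s) F i = \sum_(i <- s | deg i == k) F i.
Proof.
move=> gF gk; have [gr1 _ dir _] := grP.
set v := \sum_(i <- s) F i in gk *.
(* A common bound on [k] and all the degrees. *)
pose N := maxn k.+1 (\max_(i <- s) (deg i).+1).
(* The components of [\sum_(i <- s) F i - v], which is zero. *)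
pose U j : P := \sum_(i <- s | deg i == j) F i - (if j == k then v else 0).
have gU j : gr j (U j).
  have gj : gr j (\sum_(i <- s | deg i == j) F i).
    by apply: graded_sum => i /eqP <-.
  have gk' : gr j (if j == k then v else 0).
    by case: eqP => [->//|_]; have [] := gr1 j.
  by have := (gr1 j).2 (-1) _ _ gk' gj; rewrite scaleN1r scaleN1r addrC.
suff U0 : \sum_(j < N) U j = 0.
  have := dir N U gU U0 k; rewrite leq_maxl => /(_ isT) /eqP.
  by rewrite /U eqxx subr_eq0 => /eqP ->.
rewrite sumrB -big_mkcond (big_pred1 (Ordinal (leq_maxl k.+1 _ : (k < N)%N))) //.
rewrite (exchange_big_dep xpredT) //=; apply/eqP; rewrite subr_eq0; apply/eqP.
rewrite /v !big_seq; apply: eq_bigr => i si.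
have ltiN : (deg i < N)%N.
  by rewrite leq_max; apply/orP; right; apply: (leq_bigmax_seq (F := fun i => (deg i).+1)).
by rewrite (big_pred1 (Ordinal ltiN)) // => j; rewrite -val_eqE /= eq_sym.
Qed.

Lemma graded_qx k i v : gr k v -> gr k.+1 (qx Q i *: v).
Proof.
move=> gv; have [_ _ _ act] := grP; apply: (act 1%N) gv.
by have := qdeg_word Q [:: i]; rewrite qword_cons /qword big_nil mulr1.
Qed.

Lemma graded_qword k w v : gr k v -> gr (size w + k)%N (qword Q w *: v).
Proof. move=> gv; have [_ _ _ act] := grP; apply: act gv; exact: qdeg_word. Qed.

End GradedModule.

(** If [a_k = 0] there is nothing to prove; otherwise [b_k] is non-zero, because the
hypothesis links the supports of [a] and [b], and the identity becomes true after
multiplication by [b_k]. *)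
Lemma cocycle_of_products (K : fieldType) (m : nat) (Q : 'M[K]_m) (a b : 'I_m -> K) :
  (forall i j, a j * b i = Q i j * (a i * b j)) -> (exists i j, a j * b i != 0) ->
  forall i j k, (Q i j * Q j k - Q i k) * (a i * a j * a k) = 0.
Proof.
move=> ab [i1 [j1]]; rewrite mulf_eq0 negb_or => /andP[aj1 bi1] i j k.
have [->|ak] := eqVneq (a k) 0; first by rewrite !mulr0.
have ai1 : a i1 != 0.
  by apply: contra_neq (mulf_neq0 aj1 bi1) => ai1; rewrite ab ai1 mul0r mulr0.
have bk : b k != 0.
  by apply: contra_neq (mulf_neq0 ak bi1) => bk; rewrite ab bk !mulr0.
apply: (mulIf bk); rewrite mul0r.
have -> : (Q i j * Q j k - Q i k) * (a i * a j * a k) * b k =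
  a k * (Q i j * (a i * (Q j k * (a j * b k))) - a j * (Q i k * (a i * b k))) by ring.
rewrite -!ab; have -> : Q i j * (a i * (a k * b j)) = a k * (Q i j * (a i * b j)) by ring.
by rewrite -ab; ring.
Qed.

Section Necessity.
Variables (R : realType) (n : nat) (Q : 'M[R[i]]_n.+1).

(** Let [a] and [b] be the structure constants of the action of the generators from degree
0 to 1 and from degree 1 to 2. The point of the module is [a], the defining relations
bind [a] and [b], and some [a_j b_i] is non-zero because the degree two part is non-zero
and generated from degree 0. *)
Lemma pts_cocycle (p : proj_space R[i] n) (u : 'rV_n.+1) : pts Q p ->
  u \in pline p ->
  forall i j k, (Q i j * Q j k - Q i k) * (u 0 i * u 0 j * u 0 k) = 0.
Proof.
move=> [P [gr [[grP _ _ gr_dim] [c [phi [_ gr0 phi_surj phi_ker zl]]]]]] up.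
set e := phi 1 in gr0.
have phiE a : phi a = a *: e.
  transitivity (phi (a *: (1 : (qalg Q)^o))); last exact: linearZ.
  by congr (phi _); apply: esym; exact: mulr1.
have [e1 [gr1 e10 e1P]] := ldim1P (gr_dim 1%N).
have [e2 [gr2 e20 e2P]] := ldim1P (gr_dim 2%N).
have /choice[a aP] i : exists a, qx Q i *: e = a%:A *: e1.
  by apply: e1P; exact: graded_qx.
have /choice[b bP] i : exists b, qx Q i *: e1 = b%:A *: e2.
  by apply: e2P; exact: graded_qx.
have abP i j : qx Q i *: (qx Q j *: e) = (a j * b i)%:A *: e2.
  exact: act_comp (aP j) (bP i).
have ab_rel i j : a j * b i = Q i j * (a i * b j).
  exact: (qcomm_coef e20 (qxM Q i j) (aP i) (aP j) (bP i) (bP j)).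
have ab_neq0 : exists i j, a j * b i != 0.
  apply: contrapT => ab0; case/eqP: e20.
  have [x e2x] := phi_surj e2; have [s xs] := qalg_wordE x.
  have e2s : e2 = \sum_(t <- s) (t.1 *: qword Q t.2) *: e.
    by rewrite -scaler_suml -xs -phiE e2x.
  have gT t : gr (size t.2) ((t.1 *: qword Q t.2) *: e).
    rewrite scale_algl; apply: graded_scale => //.
    by have := graded_qword grP t.2 gr0; rewrite addn0.
  have gs : gr 2 (\sum_(t <- s) (t.1 *: qword Q t.2) *: e) by rewrite -e2s.
  rewrite e2s (graded_component grP gT gs) big1 // => -[d w] /=.
  case: w => [|i [|j []]] // _; rewrite !qword_cons /qword big_nil.
  apply: etrans (scale_word2 _ _ _ _) (etrans (congr1 _ (abP i j)) _).
  have [->|ne0] := eqVneq (a j * b i) 0; first by rewrite scale0r scale0r scaler0.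
  by case: ab0; exists i, j.
have coc := cocycle_of_products ab_rel ab_neq0.
pose v : 'rV_n.+1 := \row_i a i.
have v0 : v != 0.
  have [i [j]] := ab_neq0; rewrite mulf_eq0 negb_or => /andP[aj _].
  by apply/rV0Pn; exists j; rewrite mxE.
have vE i k : v^T i k = a i by rewrite !mxE.
have cv : c *m v^T = 0.
  apply/matrixP => m k; rewrite ord1 !mxE; apply: (algZ_eq0 e10).
  under eq_bigr => i _ do rewrite vE.
  rewrite scaler_suml scaler_suml.
  have : phi (\sum_i c m i *: qx Q i) = 0.
    apply/phi_ker; exists (fun m' => (m' == m)%:R).
    exact: sum_deltaM.
  rewrite phiE => phi0; apply: etrans phi0.
  apply: etrans (esym (scaler_suml _ _ _ _)); apply: eq_bigr => i _.
  exact: esym (scale_act _ (aP i)).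
have pv : pline p = <[v]>%VS.
    suff [<-] : [set p] (proj_point v0) by [].
    rewrite -zl => _ [m _ <-] w /= /vlineP[d ->] _.
    by rewrite meval_form linearZ /= -scalemxAr cv scaler0 mxE.
move: up; rewrite pv => /vlineP[d ->] i j k.
have := coc i j k; rewrite !mxE => cocE.
transitivity (d ^+ 3 * ((Q i j * Q j k - Q i k) * (a i * a j * a k))); first by ring.
by rewrite cocE mulr0.
Qed.

End Necessity.

(** * Coordinate subspaces *)

Section CoordinateSpaces.
Variables (K : fieldType) (n : nat).
Implicit Types (u v : 'rV[K]_n.+1) (p : proj_space K n) (s : seq 'I_n.+1).

Lemma mem_coord_span u s :
  u \in <<[seq delta_mx 0%R j | j <- s]>>%VS <-> forall j, j \notin s -> u 0 j = 0.
Proof.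
split=> [us j js|us].
  rewrite (coord_span (X := in_tuple _) us) summxE big1 // => i _.
  have si : (i < size s)%N by have := ltn_ord i; rewrite [X in (_ < X)%N]size_map.
  rewrite mxE (nth_map ord0) // mxE eqxx.
  case: eqP => [jE|_]; last by rewrite mulr0.
  by case/negP: js; rewrite jE mem_nth.
rewrite [u]row_sum_delta; apply: rpred_sum => j _.
have [js|/us ->] := boolP (j \in s); last by rewrite scale0r mem0v.
by apply: rpredZ; apply: memv_span; apply: map_f.
Qed.

Lemma coord_spaceP p s :
  coord_space s p <-> forall u, u \in pline p -> forall j, j \notin s -> u 0 j = 0.
Proof.
split=> [/subvP ps u /ps/mem_coord_span //|ps].
by apply/subvP => u /ps us; apply/mem_coord_span.
Qed.

Lemma coord_space_lineP p u s : pline p = <[u]>%VS ->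
  coord_space s p <-> forall j, j \notin s -> u 0 j = 0.
Proof.
move=> pu; split=> [/coord_spaceP ps|us]; first by apply: ps; exact: mem_pline.
by apply/coord_spaceP => v; rewrite pu => /vlineP[d ->] j /us uj; rewrite mxE uj mulr0.
Qed.

Lemma coord_space_subset s (t : seq 'I_n.+1) :
  @coord_space K n s `<=` coord_space t <-> {subset s <= t}.
Proof.
split=> [st j js|st p /coord_spaceP ps]; last first.
  by apply/coord_spaceP => u up j jt; apply: ps up _ _; apply: contra jt; exact: st.
have d0 : delta_mx 0 j != 0 :> 'rV[K]_n.+1.
  by apply/rV0Pn; exists j; rewrite mxE !eqxx oner_neq0.
have /st/(coord_space_lineP _ (pline_point _)) dt : coord_space s (proj_point d0).
  apply/(coord_space_lineP _ (pline_point _)) => i si; rewrite mxE eqxx.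
  by case: (i =P j) si => // ->; rewrite js.
by apply: contraT => /dt/eqP; rewrite mxE !eqxx oner_eq0.
Qed.

Lemma meval_ucoord i u : mpoly.meval (fun i => u 0 i) (ucoord i) = u 0 i.
Proof. exact: mpoly.mevalXU. Qed.

Lemma homogeneous_ucoord i : homogeneous (ucoord i : coord_ring K n).
Proof. by exists 1%N; rewrite mpoly.dhomogX /= mpoly.mdeg1. Qed.

Lemma homogeneous_ucoordM i j : homogeneous (ucoord i * ucoord j : coord_ring K n).
Proof.
exists (1 + 1)%N.
by apply: mpoly.dhomogM; rewrite mpoly.dhomogX /= mpoly.mdeg1.
Qed.

Lemma coord_space_closed s : zariski_closed (@coord_space K n s).
Proof.
exists [set ucoord j | j in [set j | j \notin s]].
  by move=> _ [j _ <-]; exact: homogeneous_ucoord.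
apply/seteqP; split=> p.
  by move=> /coord_spaceP ps _ [j js <-] u up _; rewrite meval_ucoord ps.
move=> ps; apply/coord_spaceP => u up j js.
have [->|u0] := eqVneq u 0; first by rewrite mxE.
by rewrite -meval_ucoord ps //; exists j.
Qed.

Definition coord_hyperplane i : set (proj_space K n) :=
  zero_locus [set (ucoord i : coord_ring K n)].

Lemma coord_hyperplane_closed i : zariski_closed (coord_hyperplane i).
Proof. by eexists; last reflexivity; move=> _ ->; exact: homogeneous_ucoord. Qed.

Lemma coord_hyperplaneP i p u : pline p = <[u]>%VS -> coord_hyperplane i p <-> u 0 i = 0.
Proof.
move=> pu; split=> [pi|ui _ -> v]; last first.
  by rewrite pu meval_ucoord => /vlineP[d ->] _; rewrite mxE ui mulr0.
have [->|u0] := eqVneq u 0; first by rewrite mxE.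
by rewrite -meval_ucoord pi //; exact: mem_pline.
Qed.

(** The restriction of [f] to the line through [u] (at [0]) and [v] (at [1]). *)
Definition line_poly u v (f : coord_ring K n) : {poly K} :=
  mpoly.mmap (@polyC K) (fun i => (u 0 i)%:P + (v 0 i - u 0 i) *: 'X) f.

Lemma horner_line_poly u v f t :
  (line_poly u v f).[t] = mpoly.meval (fun i => (u + t *: (v - u)) 0 i) f.
Proof.
rewrite /line_poly /mpoly.mmap horner_sum mpoly.mevalE; apply: eq_bigr => m _.
rewrite hornerM hornerC /mpoly.mmap1 horner_prod; congr (_ * _); apply: eq_bigr => i _.
by rewrite horner_exp !hornerE !mxE (mulrC t).
Qed.

End CoordinateSpaces.

Lemma poly_nonroot (K : numFieldType) (p : {poly K}) : p != 0 -> exists t, p.[t] != 0.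
Proof.
move=> p0; apply: contrapT => pt.
pose r : seq K := [seq k%:R | k <- iota 0 (size p)].
have r_roots : all (root p) r.
  by apply/allP => t _; apply/rootP/eqP; apply: contrapT => /negP tp; apply: pt; exists t.
have r_uniq : uniq r.
  by rewrite map_inj_uniq ?iota_uniq // => i j /eqP; rewrite eqr_nat => /eqP.
by have := max_poly_roots p0 r_roots r_uniq; rewrite size_map size_iota ltnn.
Qed.

(** If [f] does not vanish at [u] and [g] does not vanish at [v], then neither vanishes
identically on the line through [u] and [v], so both are non-zero at a common point of
that line. A coordinate that does not vanish at [u] is multiplied in, to keep the chosen
vector away from zero. *)
Lemma coord_space_irreducible (K : numFieldType) (n : nat) (s : seq 'I_n.+1) :
  s != [::] -> irreducible (@coord_space K n s).
Proof.
case: s => // j0 s _; split.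
  have d0 : delta_mx 0 j0 != 0 :> 'rV[K]_n.+1.
    by apply/rV0Pn; exists j0; rewrite mxE !eqxx oner_neq0.
  exists (proj_point d0); apply/(coord_space_lineP _ (pline_point _)) => j.
  by rewrite inE negb_or => /andP[/negPf jj0 _]; rewrite mxE jj0.
move=> _ _ [S _ ->] [T _ ->] sST; apply: contrapT => /not_orP[].
have witness (U : set (coord_ring K n)) :
    ~ coord_space (j0 :: s) `<=` zero_locus U ->
    exists (f : coord_ring K n) (u : 'rV[K]_n.+1),
    [/\ U f, u != 0, forall j, j \notin j0 :: s -> u 0 j = 0 &
      mpoly.meval (fun i => u 0 i) f != 0].
  move=> sU; apply: contrapT => nU; apply: sU => p /coord_spaceP ps f Uf u up u0.
  apply/eqP; apply: contrapT => /negP fu; apply: nU; exists f, u; split=> // j.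
  exact: ps.
move=> /witness[f [u [Sf u0 us fu]]] /witness[g [v [Tg _ vs gv]]].
have /rV0Pn[i ui] := u0.
pose F := line_poly u v f; pose G := line_poly u v g; pose H := line_poly u v (ucoord i).
have u_at0 : u + 0 *: (v - u) = u by rewrite scale0r addr0.
have v_at1 : u + 1 *: (v - u) = v by rewrite scale1r addrC subrK.
have F0 : F != 0.
  by apply: contraNneq fu => F0; rewrite -u_at0 -horner_line_poly -/F F0 horner0.
have G0 : G != 0.
  by apply: contraNneq gv => G0; rewrite -v_at1 -horner_line_poly -/G G0 horner0.
have H0 : H != 0.
  apply: contraNneq ui => H0.
  by rewrite -meval_ucoord -u_at0 -horner_line_poly -/H H0 horner0.
have [t] := poly_nonroot (mulf_neq0 (mulf_neq0 F0 G0) H0).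
rewrite !hornerM !mulf_eq0 !negb_or !horner_line_poly meval_ucoord.
set w := u + t *: (v - u) => /andP[/andP[fw gw] wi].
have w0 : w != 0 by apply/rV0Pn; exists i.
have ws : coord_space (j0 :: s) (proj_point w0).
  apply/(coord_space_lineP _ (pline_point _)) => j js.
  by rewrite !mxE us // vs // subrr mulr0 addr0.
case: (sST _ ws) => /(_ _ _ w (memv_line w) w0) zw.
  by rewrite zw ?eqxx in fw.
by rewrite zw ?eqxx in gw.
Qed.

(** * Consistent sets of indices *)

(** Transpositions of adjacent indices sort any triple; the degenerate triples reduce to
the case of two equal first indices. *)
Lemma sorted_triples (m : nat) (T : 'I_m -> 'I_m -> 'I_m -> Prop) :
  (forall i j k, T i j k -> T j i k) -> (forall i j k, T i j k -> T i k j) ->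
  (forall i k, T i i k) -> (forall i j k : 'I_m, (i < j < k)%N -> T i j k) ->
  forall i j k, T i j k.
Proof.
move=> T12 T23 Tii Tlt.
have Tij (i j k : 'I_m) : (i < j)%N -> T i j k.
  move=> ij; case: (ltngtP j k) => [jk|kj|/val_inj <-].
  - by apply: Tlt; rewrite ij.
  - apply: T23; case: (ltngtP i k) => [ik|ki|/val_inj <-//].
      by apply: Tlt; rewrite ik.
    by apply: T12; apply: Tlt; rewrite ki.
  by apply/T12/T23.
move=> i j k; case: (ltngtP i j) => [/Tij//|/Tij/T12//|/val_inj <-//].
Qed.

Section QuantumTriples.
Variables (K : fieldType) (n : nat) (Q : 'M[K]_n.+1).
Hypothesis hQ : quantum_matrix Q.

Definition consistent (i j k : 'I_n.+1) : Prop := Q i j * Q j k = Q i k.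

Definition consistent_on (s : seq 'I_n.+1) : Prop :=
  forall i j k, i \in s -> j \in s -> k \in s -> consistent i j k.

Lemma consistent_swap12 i j k : consistent i j k -> consistent j i k.
Proof. by have [Q0 _ QV] := hQ; rewrite /consistent => <-; rewrite (QV i j) mulKf. Qed.

Lemma consistent_swap23 i j k : consistent i j k -> consistent i k j.
Proof. by have [Q0 _ QV] := hQ; rewrite /consistent => <-; rewrite (QV j k) mulfK. Qed.

Lemma consistent_diag i k : consistent i i k.
Proof. by have [_ Q1 _] := hQ; rewrite /consistent Q1 mul1r. Qed.

Lemma consistent_not_uniq i j k : ~~ uniq [:: i; j; k] -> consistent i j k.
Proof.
rewrite /= !inE negb_and negbK andbT negbK => /orP[/orP[/eqP->|/eqP->]|/eqP->].
- exact: consistent_diag.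
- by apply: consistent_swap23; exact: consistent_diag.
by apply/consistent_swap12/consistent_swap23/consistent_diag.
Qed.

(** On the three indices [Q] is then a coboundary, [Q a b = Q a i * Q i b], and a coboundary
satisfies every instance of the relation. *)
Lemma consistent_on_triple i j k : consistent i j k -> consistent_on [:: i; j; k].
Proof.
move=> ijk; have [Q0 Q1 QV] := hQ.
have cob a b : a \in [:: i; j; k] -> b \in [:: i; j; k] -> Q a b = Q a i * Q i b.
  have jik := consistent_swap12 ijk.
  have kij := consistent_swap12 (consistent_swap23 ijk).
  rewrite !inE => /or3P[]/eqP-> /or3P[]/eqP->; rewrite ?Q1 ?mul1r ?mulr1 //.
  - by rewrite (QV i j) mulVf.
  - by rewrite (QV i k) mulVf.
move=> a b c sa sb sc; rewrite /consistent (cob a b) // (cob b c) // (cob a c) //.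
have ibi : Q i b * Q b i = 1 by rewrite (QV i b) divff.
by rewrite -mulrA (mulrA (Q i b)) ibi mul1r.
Qed.

(** In a matrix of rank one [Q a b = x_a y_b], and [x_b y_b = 1] by the unit diagonal.
Conversely, consistency writes the submatrix as the product of its first column by its
first row. *)
Lemma rank1_consistent (k : nat) (s : k.+1.-tuple 'I_n.+1) :
  \rank (principal_submx Q s) = 1%N <-> consistent_on s.
Proof.
have [Q0 Q1 _] := hQ; split=> [rk|cs].
  have [y [_ yE]] := row_basis_of rk.
  have /submxP[x xE] : (principal_submx Q s <= y)%MS by rewrite yE.
  have QE a b : Q (tnth s a) (tnth s b) = x a 0 * y 0 b.
    by have := congr1 (fun X : 'M_k.+1 => X a b) xE; rewrite !mxE big_ord1.
  move=> _ _ _ /tnthP[a ->] /tnthP[b ->] /tnthP[c ->]; rewrite /consistent.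
  have bb := QE b b; rewrite Q1 in bb.
  rewrite !QE; transitivity (x b 0 * y 0 b * (x a 0 * y 0 c)); first by ring.
  by rewrite -bb mul1r.
apply/anti_leq/andP; split; last first.
  rewrite lt0n mxrank_eq0; apply/eqP => /matrixP/(_ ord0 ord0).
  by rewrite !mxE; apply/eqP.
pose x := \col_(a < k.+1) Q (tnth s a) (tnth s ord0).
pose y := \row_(b < k.+1) Q (tnth s ord0) (tnth s b).
have -> : principal_submx Q s = x *m y.
  by apply/matrixP => a b; rewrite !mxE big_ord1 !mxE cs ?mem_tnth.
exact: leq_trans (mxrankM_maxl x y) (rank_leq_col x).
Qed.

End QuantumTriples.

(** * The point variety and its components *)

Lemma meval_ucoord3 (K : fieldType) (n : nat) (i j k : 'I_n.+1) (u : 'rV[K]_n.+1) :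
  mpoly.meval (fun i => u 0 i) (ucoord i * ucoord j * ucoord k) =
  u 0 i * u 0 j * u 0 k.
Proof. by rewrite !mpoly.mevalM !meval_ucoord. Qed.

Section PointVariety.
Variables (R : realType) (n : nat) (Q : 'M[R[i]]_n.+1).
Hypothesis hQ : quantum_matrix Q.

(** For the converse direction the twists are the column of [Q] at an index [o] in the
support of [u]; their compatibility is the relation for the triple [i, j, o]. *)
Lemma ptsP (p : proj_space R[i] n) : pts Q p <->
  forall u, u \in pline p -> forall i j k,
    (Q i j * Q j k - Q i k) * (u 0 i * u 0 j * u 0 k) = 0.
Proof.
split=> [pQ u up|pQ]; first exact: pts_cocycle pQ up.
have [u /rV0Pn[o uo] pu] := plineP p.
have up : u \in pline p by rewrite pu memv_line.
apply: (@mem_pts_of_twist _ _ _ hQ u o uo _ p pu) => i j.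
apply: (mulIf uo); rewrite mul0r -[RHS]oppr0 -(pQ u up i j o); ring.
Qed.

Lemma pts_supportP (p : proj_space R[i] n) : pts Q p <->
  forall u, u \in pline p -> forall i j k,
    u 0 i * u 0 j * u 0 k != 0 -> consistent Q i j k.
Proof.
split=> [/ptsP pQ u up i j k|pQ].
  move=> /negPf u0; apply/eqP; rewrite -subr_eq0; have /eqP := pQ u up i j k.
  by rewrite mulf_eq0 u0 orbF.
apply/ptsP => u up i j k; have [->|u0] := eqVneq (u 0 i * u 0 j * u 0 k) 0.
  by rewrite mulr0.
by rewrite (pQ u up i j k u0) subrr mul0r.
Qed.

Lemma pts_sortedP (p : proj_space R[i] n) : pts Q p <->
  forall u, u \in pline p -> u != 0 -> forall i j k : 'I_n.+1, (i < j < k)%N ->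
    u 0 i * u 0 j * u 0 k != 0 -> consistent Q i j k.
Proof.
split=> [/pts_supportP pQ u up _ i j k _|pQ]; first exact: pQ.
apply/pts_supportP => u up; have [->|u0] := eqVneq u 0.
  by move=> i j k; rewrite !mxE !mul0r eqxx.
apply: sorted_triples (pQ u up u0) => [i j k ijk|i j k ijk|i k _].
- by rewrite (mulrC (u 0 j)) => /ijk; exact: consistent_swap12.
- by rewrite mulrAC => /ijk; exact: consistent_swap23.
exact: consistent_diag.
Qed.

(** A point with all the coordinates in [s] equal to [1] tests every triple at once. *)
Lemma coord_space_sub_pts s :
  coord_space s `<=` pts Q <-> consistent_on Q s.
Proof.
split=> [sQ i j k si sj sk|sQ p /coord_spaceP ps].
  pose u : 'rV[R[i]]_n.+1 := \row_j (j \in s)%:R.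
  have u0 : u != 0 by apply/rV0Pn; exists i; rewrite mxE si oner_neq0.
  have /sQ/pts_supportP/(_ _ (memv_line _)) : coord_space s (proj_point u0).
    by apply/(coord_space_lineP _ (pline_point _)) => l /negPf sl; rewrite mxE sl.
  by apply; rewrite !mxE si sj sk !mulr1 oner_neq0.
apply/pts_supportP => u up i j k; rewrite !mulf_eq0 !negb_or => /andP[/andP[ui uj] uk].
have us l : u 0 l != 0 -> l \in s by apply: contraR => /(ps _ up)/eqP.
by apply: sQ; exact: us.
Qed.

Lemma plane_sub_pts i j k : coord_space [:: i; j; k] `<=` pts Q <-> consistent Q i j k.
Proof.
split=> [/coord_space_sub_pts|ijk]; first by apply; rewrite !inE eqxx ?orbT.
by apply/coord_space_sub_pts; exact: consistent_on_triple.
Qed.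

End PointVariety.

Section Components.
Variables (R : realType) (n : nat) (Q : 'M[R[i]]_n.+1).
Hypothesis hQ : quantum_matrix Q.
Local Notation coord_space := (@coord_space R[i] n).

(** Let [t] be the set of indices of the coordinates that do not vanish identically on [Z].
A triple in [t] must be consistent: otherwise [Z] would lie in the union of the three
hyperplanes, hence in one of them. *)
Lemma irreducible_pts_sub (Z : set (proj_space R[i] n)) :
  irreducible Z -> Z `<=` pts Q ->
  exists t, [/\ uniq t, consistent_on Q t & Z `<=` coord_space t].
Proof.
move=> [_ Zirr] ZQ.
pose t := [seq i <- enum 'I_n.+1 | `[< ~ Z `<=` coord_hyperplane i >]].
have tP i : (i \in t) <-> ~ Z `<=` @coord_hyperplane R[i] n i.
  by rewrite mem_filter mem_enum andbT; split=> /asboolP.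
exists t; split; first by rewrite filter_uniq ?enum_uniq.
  move=> i j k /tP Zi /tP Zj /tP Zk; apply: contrapT => nijk.
  pose V : set (proj_space R[i] n) :=
    zero_locus [set (ucoord j * ucoord k : coord_ring R[i] n)].
  have V_closed : zariski_closed V.
    by eexists; last reflexivity; move=> _ ->; exact: homogeneous_ucoordM.
  have V_sub p : V p -> (coord_hyperplane j `|` coord_hyperplane k) p.
    move=> pV; have [u u0 pu] := plineP p.
    have /eqP := pV _ erefl u (mem_pline pu) u0.
    rewrite mpoly.mevalM !meval_ucoord mulf_eq0.
    by move=> /orP[]/eqP uj; [left|right]; apply/(coord_hyperplaneP _ pu).
  case: (Zirr _ _ (coord_hyperplane_closed _ i) V_closed) => [p Zp|//|ZV].
    have /(pts_supportP hQ) pQ := ZQ _ Zp; have [u u0 pu] := plineP p.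
    have [uijk|/(pQ u (mem_pline pu))/nijk//] := eqVneq (u 0 i * u 0 j * u 0 k) 0.
    move/eqP: uijk; rewrite -mulrA mulf_eq0 => /orP[/eqP ui|/eqP ujk].
      by left; apply/(coord_hyperplaneP _ pu).
    right=> _ -> w; rewrite pu => /vlineP[d ->] _.
    by rewrite mpoly.mevalM !meval_ucoord !mxE mulrACA ujk mulr0.
  have closed := @coord_hyperplane_closed R[i] n.
  by case: (Zirr _ _ (closed j) (closed k)) => [p /ZV/V_sub|//|//].
move=> p Zp; have [u u0 pu] := plineP p; apply/(coord_space_lineP _ pu) => i it.
apply/(coord_hyperplaneP _ pu); apply: contrapT => pi.
by move/negP: it; apply; apply/tP => /(_ _ Zp).
Qed.

(** An irreducible closed set between [coord_space s] and the point variety lies in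
[coord_space t] for some consistent [t]; then [t] contains [s], and equals it if [s] is
maximal. *)
Lemma component_iff_maximal (k : nat) (s : k.+1.-tuple 'I_n.+1) :
  irreducible_component (pts Q) (coord_space s) <->
  \rank (principal_submx Q s) = 1%N /\
  forall (l : nat) (t : l.+1.-tuple 'I_n.+1), uniq t ->
    \rank (principal_submx Q t) = 1%N -> {subset s <= t} -> {subset t <= s}.
Proof.
have nonempty l (t : l.+1.-tuple 'I_n.+1) : (t : seq _) != [::].
  by rewrite -size_eq0 size_tuple.
rewrite (rank1_consistent hQ) -(coord_space_sub_pts hQ); split.
  move=> [sQ _ _ s_max]; split=> // l t _ /(rank1_consistent hQ) tQ st.
  apply/(coord_space_subset R[i]).
  rewrite -(s_max (coord_space t)) //; first exact: coord_space_closed.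
  - exact: coord_space_irreducible.
  - exact/coord_space_subset.
  exact/coord_space_sub_pts.
move=> [sQ s_max]; split=> //; first exact: coord_space_closed.
  exact: coord_space_irreducible.
move=> Z _ Zirr sZ ZQ; apply/seteqP; split=> //.
have [t [t_uniq tQ Zt]] := irreducible_pts_sub Zirr ZQ.
have st : {subset s <= t} by apply/(coord_space_subset R[i]); exact: subset_trans Zt.
have [l [t' t'E]] : exists l (t' : l.+1.-tuple 'I_n.+1), t' = t :> seq _.
  have := st _ (mem_tnth ord0 s); case: (t) => // x t1 _.
  by exists (size t1), (in_tuple (x :: t1)).
have t'_uniq : uniq t' by rewrite t'E.
have t'_rank : \rank (principal_submx Q t') = 1%N.
  by apply/(rank1_consistent hQ); rewrite t'E.
have st' : {subset s <= t'} by move=> i /st; rewrite -t'E.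
apply: subset_trans Zt _; apply/coord_space_subset => i; rewrite -t'E.
exact: (s_max _ _ t'_uniq t'_rank st').
Qed.

End Components.

Theorem theorem1 (R : realType) (n : nat) (Q : 'M[R[i]]_n.+1)
    (hQ : quantum_matrix Q) :
  [/\ (* (1) *)
      pts Q = zero_locus [set f : coord_ring R[i] n |
        exists i j k : 'I_n.+1, (i < j < k)%N /\
          f = (Q i j * Q j k - Q i k) *: (ucoord i * ucoord j * ucoord k)]
      /\ (exists S : set (seq 'I_n.+1),
            (forall s, S s -> uniq s /\ s != [::]) /\
            pts Q = \bigcup_(s in S) coord_space s),
      (* (2) *)
      forall (k : nat) (s : k.+1.-tuple 'I_n.+1), uniq s ->
        (irreducible_component (pts Q) (coord_space s) <->
         \rank (principal_submx Q s) = 1%N /\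
         forall (l : nat) (t : l.+1.-tuple 'I_n.+1), uniq t ->
           \rank (principal_submx Q t) = 1%N -> {subset s <= t} -> {subset t <= s})
    & (* (3) *)
      pts Q = zero_locus [set f : coord_ring R[i] n |
        exists i j k : 'I_n.+1,
          [/\ (i < j < k)%N, ~ coord_space [:: i; j; k] `<=` pts Q &
              f = ucoord i * ucoord j * ucoord k]]
      /\ (forall Q' : 'M[R[i]]_n.+1, quantum_matrix Q' ->
            (forall i j k : 'I_n.+1, uniq [:: i; j; k] ->
               (coord_space [:: i; j; k] `<=` pts Q <->
                coord_space [:: i; j; k] `<=` pts Q')) ->
            pts Q = pts Q')].
Proof.
split; [split|move=> k s _|split].
- apply/seteqP; split=> p; first move=> /(ptsP hQ) pQ _ [i [j [k [_ ->]]]] u up _.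
    by rewrite mpoly.mevalZ meval_ucoord3 pQ.
  move=> pQ; apply/(pts_sortedP hQ) => u up u0 i j k ijk uijk.
  apply/eqP; rewrite -subr_eq0.
  have : (Q i j * Q j k - Q i k) * (u 0 i * u 0 j * u 0 k) = 0.
    by rewrite -meval_ucoord3 -mpoly.mevalZ pQ //; exists i, j, k.
  by move=> /eqP; rewrite mulf_eq0 (negPf uijk) orbF.
- exists [set s | [/\ uniq s, s != [::] & consistent_on Q s]]; split.
    by move=> s [].
  apply/seteqP; split=> p; last first.
    by move=> [s [_ _ /(coord_space_sub_pts hQ)]]; exact.
  move=> /(pts_supportP hQ) pQ; have [u /rV0Pn[o uo] pu] := plineP p.
  (* A point lies in the coordinate subspace of its own support. *)
  pose s := [seq j <- enum 'I_n.+1 | u 0 j != 0].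
  have su l : (l \in s) = (u 0 l != 0) by rewrite mem_filter mem_enum andbT.
  exists s.
    split; first by rewrite filter_uniq ?enum_uniq.
      by apply/eqP => s0; have := su o; rewrite s0 uo.
    move=> i j k; rewrite !su => ui uj uk.
    by apply: (pQ u (mem_pline pu)); rewrite !mulf_neq0.
  by apply/(coord_space_lineP _ pu) => j; rewrite su negbK => /eqP.
- exact: component_iff_maximal.
- apply/seteqP; split=> p.
    move=> /(pts_supportP hQ) pQ _ [i [j [k [_ nijk ->]]]] u up _.
    rewrite meval_ucoord3; apply/eqP; apply: contrapT => /negP /(pQ _ up) ijk.
    by apply: nijk; apply/plane_sub_pts.
  move=> pQ; apply/(pts_sortedP hQ) => u up u0 i j k ijk uijk.
  apply/(plane_sub_pts hQ); apply: contrapT => nijk.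
  by case/eqP: uijk; rewrite -meval_ucoord3 pQ //; exists i, j, k.
move=> Q' hQ' planes.
have cons i j k : consistent Q i j k <-> consistent Q' i j k.
  have [/planes e|nu] := boolP (uniq [:: i; j; k]).
    by rewrite -plane_sub_pts // e plane_sub_pts.
  by split=> _; exact: consistent_not_uniq.
apply/seteqP; split=> p.
  by move=> /(pts_supportP hQ) pQ; apply/(pts_supportP hQ') => u up i j k /(pQ u up)/cons.
by move=> /(pts_supportP hQ') pQ; apply/(pts_supportP hQ) => u up i j k /(pQ u up)/cons.
Qed.
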